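(* Let $(C_j)_{j\in J}$ be a countable family of diagonal matrices $C_j\in\mathrm{GL}(d,\mathbb R)$ for which there is a constant, independent of $j$, bounding for all $j\in J$ the quotient of the maximal singular value of $C_j$ divided by the minimal singular value of $C_j$. Let $\bigcup_{j\in J}\{T_\gamma g_{j,p}\}_{\gamma\in C_j\mathbb Z^d,\,p\in P_j}$ be a generalised translation-invariant system in $L^2(\mathbb R^d)$ and let $E\subseteq\widehat{\mathbb R}^d$ be a closed set of Lebesgue measure zero. Then the following assertions are equivalent: (i) The system $\bigcup_{j\in J}\{T_\gamma g_{j,p}\}_{\gamma\in C_j\mathbb Z^d,\,p\in P_j}$ satisfies the local integrability condition with respect to $E$. (ii) The system $\bigcup_{j\in J}\{T_\gamma g_{j,p}\}_{\gamma\in C_j\mathbb Z^d,\,p\in P_j}$ satisfies the Calderón integrability condition with respect to $E$ and its generating functions are strictly temperate with respect to $E$.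
   Context: $\mathbb R^d$ carries Lebesgue measure, and $\widehat{\mathbb R}^d$ is identified with $\mathbb R^d$ (written additively) via the characters $x\mapsto e^{2\pi i x\cdot\omega}$. $\hat f$ is the Fourier–Plancherel transform, $T_\gamma f=f(\cdot-\gamma)$. For $\Gamma=C\mathbb Z^d$ with $C\in\mathrm{GL}(d,\mathbb R)$, the annihilator is $\Gamma^\perp=(C^T)^{-1}\mathbb Z^d$ and the covolume is $\mathrm{d}(\Gamma)=|\det C|$ ($\Gamma$ carrying counting measure). Generalised translation-invariant system (with lattices $\Gamma_j=C_j\mathbb Z^d$): $J$ is countable; for each $j\in J$, $P_j$ is an index set with functions $g_{j,p}\in L^2(\mathbb R^d)$, $p\in P_j$; the system is $\bigcup_{j\in J}\{T_\gamma g_{j,p}:\gamma\in\Gamma_j,p\in P_j\}$. Standing hypotheses for each $j$: (I) $(P_j,\Sigma_{P_j},\mu_{P_j})$ is a $\sigma$-finite measure space; (II) $p\mapsto g_{j,p}$ is measurable from $(P_j,\Sigma_{P_j})$ to $L^2(\mathbb R^d)$ with its Borel $\sigma$-algebra; (III) $(p,x)\mapsto g_{j,p}(x)$ is jointly measurable for $\Sigma_{P_j}\otimes\mathcal B_{\mathbb R^d}$. Local integrability condition (w.r.t. $E$): for all $f\in L^2(\mathbb R^d)$ such that $\hat f\in L^\infty$ has compact support contained in $\widehat{\mathbb R}^d\setminus E$, $$\sum_{j\in J}\frac1{\mathrm{d}(\Gamma_j)}\int_{P_j}\sum_{\alpha\in\Gamma_j^\perp}\int_{\operatorname{supp}\hat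 f}|\hat f(\omega+\alpha)\hat g_{j,p}(\omega)|^2\,d\omega\,d\mu_{P_j}(p)<\infty.$$ Calderón integrability condition (w.r.t. $E$): $\sum_{j\in J}\frac1{\mathrm{d}(\Gamma_j)}\int_{P_j}|\hat g_{j,p}(\cdot)|^2\,d\mu_{P_j}(p)\in L^1_{\mathrm{loc}}(\widehat{\mathbb R}^d\setminus E)$, i.e. it is integrable over every compact $K\subseteq\widehat{\mathbb R}^d\setminus E$. Strictly temperate (w.r.t. $E$): $\sum_{j\in J}\int_{P_j}|\hat g_{j,p}(\cdot)|^2\,d\mu_{P_j}(p)\in L^1_{\mathrm{loc}}(\widehat{\mathbb R}^d\setminus E)$. *)

(* Defs.v *)
From HB Require Import structures.
From mathcomp Require Import all_boot all_order all_algebra.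
From mathcomp Require Import all_classical all_reals all_analysis measurable_realfun.
From mathcomp.real_closed Require Import complex.

Set Implicit Arguments.
Unset Strict Implicit.
Unset Printing Implicit Defensive.

Import Order.TTheory GRing.Theory Num.Theory.
Import numFieldNormedType.Exports Normc.

Local Open Scope classical_set_scope.
Local Open Scope ring_scope.

Section Borel_rV.
Context (R : realType) (n : nat).

HB.instance Definition _ := Measurable.copy 'rV[R]_n
  (g_sigma_algebraType (@open 'rV[R]_n)).

Lemma open_measurable_rV (U : set 'rV[R]_n) : open U -> measurable U.
Proof. by move=> oU; apply: sub_sigma_algebra. Qed.

Lemma measurable_coord_rV (i : 'I_n) :
  measurable_fun [set: 'rV[R]_n] (fun v => v ord0 i).
Proof.
apply: (measurability _ (RGenOpens.measurableE R)) => // _ [_ [a [b ->]] <-].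
rewrite setTI; apply: open_measurable_rV; apply: open_comp; last first.
  exact: interval_open.
by move=> v _; exact: coord_continuous.
Qed.

End Borel_rV.

Section cons_rV.
Context (R : realType) (n : nat).

Definition cons_rV (p : measurableTypeR R * 'rV[R]_n) : 'rV[R]_n.+1 :=
  row_mx (const_mx p.1 : 'rV_1) p.2.

Lemma cons_rV0 p : cons_rV p ord0 ord0 = p.1.
Proof. by rewrite mxE; case: splitP => // j _; rewrite mxE. Qed.

Lemma cons_rVS p j : cons_rV p ord0 (lift ord0 j) = p.2 ord0 j.
Proof.
rewrite (_ : lift ord0 j = rshift 1 j :> 'I_(1 + n)); last exact/val_inj.
exact: row_mxEr.
Qed.

Let cons_rV_ball (p q : R * 'rV[R]_n) (e : R) :
  0 < e -> ball p.1 e q.1 -> ball p.2 e q.2 -> ball (cons_rV p) e (cons_rV q).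
Proof.
move=> e0 b1 [_ b2]; split => // i j; rewrite /cons_rV !mxE.
by case: splitP => k _; rewrite ?mxE //; exact: b2.
Qed.

Let box (i : rat * 'rV[rat]_n * nat) : set (measurableTypeR R * 'rV[R]_n) :=
  ball (ratr i.1.1 : R) i.2.+1%:R^-1 `*`
  ball (map_mx ratr i.1.2 : 'rV[R]_n) i.2.+1%:R^-1.

Let measurable_box i : measurable (box i).
Proof.
apply: measurableX; first exact: measurable_ball.
by apply: open_measurable_rV; apply: ball_open; rewrite invr_gt0.
Qed.

Let rat_ball (x e : R) : 0 < e -> exists q : rat, ball (ratr q : R) e x.
Proof.
move=> e0; have [|q] := @rat_in_itvoo R (x - e) (x + e).
  by rewrite ltrBlDr -addrA ltrDl addr_gt0.
rewrite in_itv/= => /andP[xq qx]; exists q.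
by rewrite /ball/= ltr_distl xq.
Qed.

Lemma measurable_cons_rV : measurable_fun [set: measurableTypeR R * 'rV[R]_n] cons_rV.
Proof.
apply: (measurability (@open 'rV[R]_n.+1)) => // _ [U oU <-].
rewrite setTI.
pose F i := if `[< box i `<=` cons_rV @^-1` U >] then box i else set0.
suff -> : cons_rV @^-1` U = \bigcup_i F i.
  apply: countable_bigcupT_measurable => // i.
  by rewrite /F; case: ifPn => // _; exact: measurable_box.
apply/seteqP; split => [p /= Up|p [i _]]; last first.
  by rewrite /F; case: ifPn => // /asboolP; apply.
have := oU; rewrite openE => /(_ _ Up).
rewrite /interior => /nbhs_ballP[e /= e0 eU].
have e20 : 0 < e / 2 by rewrite divr_gt0.
have [k ke] : exists k : nat, k.+1%:R^-1 < e / 2.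
  have [k _ ke] := near_infty_natSinv_lt (PosNum e20).
  by exists k; exact: ke (leqnn k).
have k0 : 0 < k.+1%:R^-1 :> R by rewrite invr_gt0.
have [q qp] := rat_ball p.1 k0.
have /choice[v vp] : forall j, exists r : rat,
    ball (ratr r : R) k.+1%:R^-1 (p.2 ord0 j).
  by move=> j; exact: rat_ball.
pose i := (q, (\row_j v j)%R, k).
have bip : box i p.
  by split => //=; split => // j1 j; rewrite (ord1 j1) !mxE.
exists i => //; rewrite /F; case: ifPn => // /asboolP; apply.
move=> p' [b1 b2]; apply: eU; case: bip => c1 c2.
have h : (k.+1%:R^-1 + k.+1%:R^-1 : R) <= e.
  by rewrite (splitr e) lerD// ltW.
apply: cons_rV_ball => //; apply: (le_ball h).
- by apply: ball_triangle b1; exact: ball_sym.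
- by apply: ball_triangle b2; exact: ball_sym.
Qed.

Let behead_rV (v : 'rV[R]_n.+1) : measurableTypeR R * 'rV[R]_n :=
  (v ord0 ord0, rsubmx (v : 'rV_(1 + n))).

Let cons_rVK : cancel cons_rV behead_rV.
Proof.
move=> [x v]; rewrite /behead_rV /cons_rV /=; congr pair; last exact: row_mxKr.
exact: (cons_rV0 (x, v)).
Qed.

Let measurable_behead_rV : measurable_fun [set: 'rV[R]_n.+1] behead_rV.
Proof.
apply: measurable_fun_pair => /=.
  exact: measurable_coord_rV.
apply: (measurability (@open 'rV[R]_n)) => // _ [U oU <-].
rewrite setTI; apply: open_measurable_rV; apply: open_comp => // v _.
move=> A /nbhs_ballP[e /= e0 eA]; apply/nbhs_ballP; exists e => //= w [_ vw].
by apply: eA; split => // i j; rewrite !mxE; exact: vw.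
Qed.

Variable m : {sigma_finite_measure set 'rV[R]_n -> \bar R}.

Definition lebesgue_cons : set 'rV[R]_n.+1 -> \bar R :=
  pushforward (lebesgue_measure \x m)%E cons_rV.

Let cons_preimage A : measurable A -> measurable (cons_rV @^-1` A).
Proof. by move=> mA; rewrite -[X in measurable X]setTI; exact: measurable_cons_rV. Qed.

Let lebesgue_cons0 : lebesgue_cons set0 = 0%E.
Proof. by rewrite /lebesgue_cons /pushforward preimage_set0 measure0. Qed.

Let lebesgue_cons_ge0 A : (0 <= lebesgue_cons A)%E.
Proof. by rewrite /lebesgue_cons /pushforward measure_ge0. Qed.

Let lebesgue_cons_sigma_additive : semi_sigma_additive lebesgue_cons.
Proof.
move=> F mF tF mUF; rewrite /lebesgue_cons /pushforward preimage_bigcup.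
apply: measure_semi_sigma_additive.
- by move=> i; exact: cons_preimage.
- apply/trivIsetP => /= i j _ _ ij; rewrite -preimage_setI.
  by move/trivIsetP : tF => /(_ _ _ _ _ ij) ->//; rewrite preimage_set0.
- by rewrite -preimage_bigcup; exact: cons_preimage.
Qed.

HB.instance Definition _ := isMeasure.Build _ _ _ lebesgue_cons
  lebesgue_cons0 lebesgue_cons_ge0 lebesgue_cons_sigma_additive.

Let lebesgue_cons_sigma_finite : sigma_finite setT lebesgue_cons.
Proof.
have /sigma_finiteP[F [TF ndF Foo]] :=
  @sigma_finiteT _ (measurableTypeR R) R lebesgue_measure.
have /sigma_finiteP[G [TG ndG Goo]] := sigma_finiteT m.
exists (fun k => behead_rV @^-1` (F k `*` G k)).
  rewrite -preimage_bigcup -[LHS](preimage_setT behead_rV).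
  congr (_ @^-1` _).
  rewrite -setXTT TF TG predeqE => -[x y]; split.
    move=> [/= [k _ Fkx] [l _ Gly]]; exists (maxn k l) => //; split.
    - by move: x Fkx; exact/subsetPset/ndF/leq_maxl.
    - by move: y Gly; exact/subsetPset/ndG/leq_maxr.
  by move=> [k _ []/= ? ?]; split; exists k.
move=> k; have [mF Fk] := Foo k; have [mG Gk] := Goo k; split.
  rewrite -[X in measurable X]setTI; apply: measurable_behead_rV => //.
  exact: measurableX.
rewrite /lebesgue_cons /pushforward -comp_preimage.
rewrite (_ : behead_rV \o cons_rV = id); last exact/funext/cons_rVK.
by rewrite preimage_id product_measure1E// lte_mul_pinfty// ge0_fin_numE.
Qed.

HB.instance Definition _ := Measure_isSigmaFinite.Build _ _ _ lebesgue_cons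
  lebesgue_cons_sigma_finite.

End cons_rV.

(* The product measure is built by recursion on the dimension, prepending one
   coordinate at a time; [lebesgue_rV_box] gives its value on boxes. *)
Fixpoint lebesgue_rV (R : realType) (n : nat) :
    {sigma_finite_measure set 'rV[R]_n -> \bar R} :=
  if n is n'.+1 then lebesgue_cons (lebesgue_rV R n') else \d_(0 : 'rV[R]_0).

Definition boxR (R : realType) (n : nat) (A : 'I_n -> set R) : set 'rV[R]_n :=
  [set v | forall i, A i (v ord0 i)].

Lemma measurable_boxR (R : realType) (n : nat) (A : 'I_n -> set R) :
  (forall i, measurable (A i)) -> measurable (boxR A).
Proof.
move=> mA; rewrite (_ : boxR A = \bigcap_(i in [set: 'I_n])
    ((fun v : 'rV[R]_n => v ord0 i) @^-1` A i)); last first.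
  by apply/seteqP; split => v h i; [move=> _; exact: h | exact: (h i I)].
apply: fin_bigcap_measurable => //.
move=> i _; rewrite -[X in measurable X]setTI; exact: measurable_coord_rV.
Qed.

Lemma lebesgue_rV_box (R : realType) (n : nat) (A : 'I_n -> set R) :
  (forall i, measurable (A i)) ->
  lebesgue_rV R n (boxR A) = (\prod_(i < n) lebesgue_measure (A i))%E.
Proof.
elim: n A => [|n IH] A mA.
  rewrite big_ord0 /= diracE mem_set//; by move=> [].
rewrite big_ord_recl -IH//= /lebesgue_cons /pushforward -product_measure1E//=.
  congr ((_ \x _) _)%E; apply/seteqP; split => -[x v] /=.
    move=> h; split => [|i] /=; first by have := h ord0; rewrite cons_rV0.
    by have := h (lift ord0 i); rewrite cons_rVS.
  by move=> [h1 h2] i; case: (unliftP ord0 i) => [j|] ->;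
    rewrite ?cons_rV0 ?cons_rVS//; exact: h2.
  exact: mA.
by apply: measurable_boxR => i; exact: mA.
Qed.

Section L2_Fourier.
Context (R : realType) (d : nat).
Local Notation mu := (lebesgue_rV R d).
Local Notation C := R[i].

(* Measurability for the Borel sets of [C], identified with [R * R]. *)
Definition cmeasurable dT (T : measurableType dT) (f : T -> C) : Prop :=
  measurable_fun [set: T] (fun x => complex.Re (f x)) /\
  measurable_fun [set: T] (fun x => complex.Im (f x)).

Definition cLnorm (p : \bar R) (f : 'rV[R]_d -> C) : \bar R :=
  Lnorm mu p (fun x => (normc (f x))%:E).

(* Elements of [L^p] are given by Borel representatives; everything below is
   compatible with equality almost everywhere. *)
Definition Lp (p : \bar R) : set ('rV[R]_d -> C) :=
  [set f | cmeasurable f /\ (cLnorm p f < +oo)%E].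

Definition dot (x w : 'rV[R]_d) : R := \sum_i x ord0 i * w ord0 i.

Definition expi (t : R) : C := (cos t +i* sin t)%C.

Definition cintegral (f : 'rV[R]_d -> C) : C :=
  ((\int[mu]_x complex.Re (f x)) +i* (\int[mu]_x complex.Im (f x)))%C.

Definition fourier_L1 (f : 'rV[R]_d -> C) (w : 'rV[R]_d) : C :=
  cintegral (fun x => f x * expi (- (2 * pi * dot x w))).

(* The graph of the Fourier-Plancherel transform, that is, of the extension by
   continuity to [L^2] of [fourier_L1] on the intersection of [L^1] and [L^2]. *)
Definition plancherel (f F : 'rV[R]_d -> C) : Prop :=
  [/\ Lp 2%:E f, Lp 2%:E F &
    exists u : nat -> 'rV[R]_d -> C,
      [/\ forall n, Lp 1%:E (u n) /\ Lp 2%:E (u n),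
          cLnorm 2%:E (u n \- f) @[n --> \oo] --> 0%E &
          cLnorm 2%:E (fourier_L1 (u n) \- F) @[n --> \oo] --> 0%E]].

(* Essential support, the support of an almost-everywhere class. *)
Definition ess_supp (f : 'rV[R]_d -> C) : set 'rV[R]_d :=
  [set x | forall U, nbhs x U -> ~ mu.-negligible (U `&` [set y | f y != 0])].

(* Open sets of the seminorm topology: they are saturated for equality almost
   everywhere, hence are the open sets of the quotient [L^2]. *)
Definition L2_open (U : set ('rV[R]_d -> C)) : Prop :=
  U `<=` Lp 2%:E /\
  forall f, U f -> exists2 e : R, 0 < e &
    forall h, Lp 2%:E h -> (cLnorm 2%:E (h \- f)%R < e%:E)%E -> U h.

Definition L2_borel : set (set ('rV[R]_d -> C)) := <<s Lp 2%:E, L2_open >>.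

Section generators.
Context (dP : measure_display) (P : measurableType dP).
Implicit Types g h : P -> 'rV[R]_d -> C.

Definition L2_measurable g : Prop :=
  forall B, L2_borel B -> measurable (g @^-1` B).

Definition jointly_measurable g : Prop :=
  cmeasurable (fun q : P * 'rV[R]_d => g q.1 q.2).

Definition gti_generators g : Prop :=
  [/\ forall p, Lp 2%:E (g p), L2_measurable g & jointly_measurable g].

(* A jointly measurable version of [(p, w) |-> (g p)^(w)]. It exists for every
   [g] satisfying [gti_generators g] and a sigma-finite measure on [P], and two
   versions agree almost everywhere in [w] for each [p]. Choosing
   representatives separately for each [p] would not be enough to integrate
   over [p] at a fixed frequency [w]. *)
Definition fourier_family g : P -> 'rV[R]_d -> C :=
  xget (fun _ _ => 0)
    [set h | jointly_measurable h /\ forall p, plancherel (g p) (h p)].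

End generators.

Definition loc_integrable_off (E : set 'rV[R]_d) (h : 'rV[R]_d -> \bar R) :
    Prop :=
  forall K, compact K -> K `<=` ~` E -> mu.-integrable K h.

(* The lattice [A Z^d], written with row vectors. *)
Definition lattice (A : 'M[R]_d) : set 'rV[R]_d :=
  range (fun k : 'rV[int]_d => map_mx intr k *m A^T).

Definition annihilator (A : 'M[R]_d) : set 'rV[R]_d := lattice (invmx A^T).

Definition covolume (A : 'M[R]_d) : R := `|\det A|.

Definition singular_values (A : 'M[R]_d) : set R :=
  [set s | 0 <= s /\ eigenvalue (A^T *m A) (s ^+ 2)].

Definition max_singular_value (A : 'M[R]_d) : R := sup (singular_values A).
Definition min_singular_value (A : 'M[R]_d) : R := inf (singular_values A).

Section conditions.
Context (J : countType) (A : J -> 'M[R]_d)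
  (dP : J -> measure_display) (P : forall j, measurableType (dP j))
  (muP : forall j, {measure set (P j) -> \bar R})
  (g : forall j, P j -> 'rV[R]_d -> C) (E : set 'rV[R]_d).
Local Notation ghat j := (fourier_family (@g j)).
Local Open Scope ereal_scope.

Definition local_integrability_condition : Prop :=
  forall f F : 'rV[R]_d -> C, plancherel f F -> cLnorm +oo F < +oo ->
    compact (ess_supp F) -> ess_supp F `<=` ~` E ->
    \esum_(j in [set: J]) ((covolume (A j))^-1%:E *
      \int[muP j]_p \esum_(a in annihilator (A j))
        \int[mu]_(w in ess_supp F)
          ((normc (F (w + a) * ghat j p w)%R) ^+ 2)%:E) < +oo.

Definition calderon_integrability_condition : Prop :=
  loc_integrable_off E (fun w =>
    \esum_(j in [set: J]) ((covolume (A j))^-1%:E *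
      \int[muP j]_p ((normc (ghat j p w)) ^+ 2)%:E)).

Definition strictly_temperate : Prop :=
  loc_integrable_off E (fun w =>
    \esum_(j in [set: J]) \int[muP j]_p ((normc (ghat j p w)) ^+ 2)%:E).

End conditions.

End L2_Fourier.

(* Main.v *)
(* Write h_j(w) for the integral over P_j of |g_{j,p}^(w)|^2. By Tonelli, the j-th
   term of the local integrability condition is 1/d(Gamma_j) times the integral
   over supp F of h_j(w) times the sum over Gamma_j^perp of |F(w + a)|^2.

   Since C_j is diagonal with bounded condition number, the number of points of
   Gamma_j^perp in a box of side l lies, up to constants, between l^d d(Gamma_j)
   and 1 + l^d d(Gamma_j). For bounded F with compact support, the upper bound
   gives a j-th term at most const (1 + 1/d(Gamma_j)) times the integral of h_j
   over supp F, so (ii) implies (i).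

   Conversely, near a point off E take for F a product of tent functions. The
   lattice point 0 alone bounds the integral of h_j / d(Gamma_j) over a small
   ball, and all the lattice points of size at most s/4 together bound the
   integral of h_j; a compact set is covered by finitely many such balls.

   That a tent is a Fourier transform needs no inversion theorem: the integral
   of (1 - cos(2 pi a t)) / t^2 is proportional to |a| by homogeneity, and
   multiplying (1 - cos(2 pi s t)) / t^2 by cos(2 pi t y) gives the combination
   of such functions whose integral is (|y + s| + |y - s|) / 2 - |y|. *)

Require Import Defs.
From mathcomp Require Import all_boot all_order all_algebra.
From mathcomp Require Import all_classical all_reals all_analysis.
From mathcomp Require Import measurable_realfun ess_sup_inf.
From mathcomp.real_closed Require Import complex.
From mathcomp Require Import ring lra zify.

Set Implicit Arguments.
Unset Strict Implicit.
Unset Printing Implicit Defensive.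

Import Order.TTheory GRing.Theory Num.Theory numFieldNormedType.Exports.
Import Normc.

Local Open Scope classical_set_scope.
Local Open Scope ring_scope.

(** * Sums, integrals and translations *)

Section measure_generalities.
Context dT (T : measurableType dT) (R : realType).
Variable m : {measure set T -> \bar R}.
Local Open Scope ereal_scope.

(* Unlike [ge0_le_integral], this does not ask the integrands to be measurable. *)
Lemma le_ge0_integral (D : set T) (f g : T -> \bar R) :
  (forall x, D x -> 0 <= f x) -> (forall x, D x -> f x <= g x) ->
  \int[m]_(x in D) f x <= \int[m]_(x in D) g x.
Proof.
move=> f0 fg; rewrite !(integral_mkcond D).
rewrite !ge0_integralTE//; last 2 first.
- by move=> x; apply: erestrict_ge0 => y Dy; exact: le_trans (f0 _ Dy) (fg _ Dy).
- by move=> x; exact: erestrict_ge0.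
apply: le_ereal_sup => _ [h /= hf <-]; exists h => //= x.
by rewrite (le_trans (hf x))//; exact: lee_restrict.
Qed.

(** Passing to codes turns the sum into a series over [nat], to which monotone convergence applies;
    numbers that encode no index contribute 0. *)
Lemma countable_esumE (J : countType) (a : J -> \bar R) : (forall j, 0 <= a j) ->
  \esum_(j in [set: J]) a j =
  \sum_(n <oo) oapp a 0 (pickle_inv n).
Proof.
move=> a0; rewrite nneseries_esumT; last by move=> n; case: pickle_inv => //=.
rewrite (esumID (range (@pickle J)))//; last by move=> n _; case: pickle_inv => //=.
rewrite !setTI [X in _ + X]esum1 ?adde0; last first.
  move=> n /= nJ; case E : (pickle_inv n) => [j|//]; exfalso; apply: nJ.
  by exists j => //; have := @pickle_invK J n; rewrite /ocancel E.
rewrite (esum_image _ (@pickle J)); last by move=> i j _ _; exact: (pcan_inj (@pickleK_inv J)).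
by apply: eq_esum => j _; rewrite pickleK_inv.
Qed.

Variables (J : countType) (f : J -> T -> \bar R).
Hypothesis f0 : forall j x, 0 <= f j x.
Hypothesis mf : forall j, measurable_fun [set: T] (f j).

Let g n x := oapp (f^~ x) 0 (pickle_inv n : option J).

Let g0 n x : 0 <= g n x.
Proof. by rewrite /g; case: pickle_inv => //=. Qed.

Let mg n : measurable_fun [set: T] (g n).
Proof. by rewrite /g; case: pickle_inv => //=. Qed.

Lemma measurable_esum :
  measurable_fun [set: T] (fun x => \esum_(j in [set: J]) f j x).
Proof.
under eq_fun do rewrite countable_esumE//.
exact: (@ge0_emeasurable_sum _ _ _ _ g xpredT).
Qed.

Lemma integral_esum (D : set T) : measurable D ->
  \int[m]_(x in D) (\esum_(j in [set: J]) f j x) =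
  \esum_(j in [set: J]) \int[m]_(x in D) f j x.
Proof.
move=> mD; under eq_integral do rewrite countable_esumE//.
rewrite (integral_nneseries m mD (f := g))//;
  last by move=> n; exact: measurable_funTS.
rewrite countable_esumE; last by move=> j; exact: integral_ge0.
apply: eq_eseriesr => n _; rewrite /g; case: pickle_inv => //=.
exact: integral0.
Qed.

End measure_generalities.

(** The image of [e] is a finite subset of [D], so its partial sum is a lower bound. It converts a
    count of lattice points into a bound on a lattice sum. *)
Lemma esum_ge_card (R : realType) (I : finType) (T : choiceType) (D : set T) (e : I -> T)
    (t : T -> \bar R) (t0 : \bar R) : injective e -> (forall i, D (e i)) ->
  (forall i, t0 <= t (e i))%E ->
  (#|I|%:R%:E * t0 <= \esum_(a in D) t a)%E.
Proof.
move=> einj De tt; apply: esum_ge; exists [set` map e (enum I)].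
  split; first exact: finite_seq.
  by move=> _ /= /mapP[i _ ->]; exact: De.
rewrite -fsbig_seq ?(map_inj_uniq einj) ?enum_uniq// big_map big_enum/=.
apply: (@le_trans _ _ (\sum_(i : I) t0)%E); last by apply: lee_sum.
rewrite big_const (_ : #|xpredT| = #|I|)//; elim: #|I| => [|m IH]; first by rewrite mul0e.
by rewrite -natr1 EFinD ge0_muleDl ?lee_fin// mul1e addeC/= leeD2l.
Qed.

Lemma esumZl (R : realType) (J : countType) (a : J -> \bar R) (r : R) :
  (0 <= r)%R -> (forall j, 0 <= a j)%E ->
  (\esum_(j in [set: J]) (r%:E * a j) = r%:E * \esum_(j in [set: J]) a j)%E.
Proof.
move=> r0 a0; rewrite !countable_esumE//; last by move=> j; rewrite mule_ge0.
rewrite -nneseriesZl; last by move=> n _; case: pickle_inv => /=.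
by apply: eq_eseriesr => n _; case: pickle_inv => //=; rewrite mule0.
Qed.

Lemma measurable_xshift (R : realType) n (a : 'rV[R]_n) :
  measurable_fun [set: 'rV[R]_n] (fun v : 'rV[R]_n => (v + a : 'rV[R]_n)).
Proof.
apply: (measurability (@open 'rV[R]_n)) => // _ [U oU <-].
rewrite setTI; apply: open_measurable_rV; apply: open_comp => // v _.
exact: (cvgD cvg_id (cvg_cst a)).
Qed.

(** * Translation invariance of Lebesgue measure *)

Section lebesgue_shift.
Context (R : realType).

(** Lebesgue measure is determined by its values on half-open intervals, and a shift preserves their
    lengths. *)
Lemma lebesgue_measure_shift (a : R) (A : set R) : measurable A ->
  lebesgue_measure ((fun x => x + a) @^-1` A) = lebesgue_measure A.
Proof.
move=> mA; rewrite -[LHS]/(pushforward lebesgue_measure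
  ((fun x => x + a) : measurableTypeR R -> measurableTypeR R) A).
apply/esym/lebesgue_measure_unique => //=.
  by apply: measurable_funD => //; exact: measurable_id.
move=> _ _ [[b c]] _ <-.
rewrite /pushforward.
rewrite (_ : _ @^-1` _ = `]b - a, c - a]%classic); last first.
  by apply/seteqP; split => x /=; rewrite !in_itv/= ltrBlDr lerBrDr.
rewrite !lebesgue_measure_itv/= !lte_fin ltrD2r; case: ifP => // _.
by rewrite -!EFinD; congr EFin; rewrite opprD opprK addrACA addNr addr0.
Qed.

Lemma ge0_integral_shift (a : R) (f : measurableTypeR R -> \bar R) :
  measurable_fun [set: measurableTypeR R] f -> (forall x, 0 <= f x)%E ->
  (\int[lebesgue_measure]_x f (x + a)%R = \int[lebesgue_measure]_x f x)%E.
Proof.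
move=> mf f0; pose t : measurableTypeR R -> measurableTypeR R := fun x => (x + a)%R.
have mt : measurable_fun setT t by apply: measurable_funD => //; exact: measurable_id.
have := ge0_integral_pushforward mt (@lebesgue_measure R) measurableT mf
  (fun x _ => f0 x).
rewrite preimage_setT => <-; apply: eq_measure_integral => A mA _.
exact: lebesgue_measure_shift.
Qed.

(** Induction on the dimension: the measure integrates the measures of sections. Shifting the tail
    preserves each of these by induction, and shifting the first coordinate preserves the outer
    integral. *)
Lemma lebesgue_rV_shift n (a : 'rV[R]_n) (A : set 'rV[R]_n) : measurable A ->
  lebesgue_rV R n ((fun v => v + a) @^-1` A) = lebesgue_rV R n A.
Proof.
elim: n a A => [|n IH] a A mA.
  congr (lebesgue_rV R _ _); apply/seteqP; split=> v /=; by rewrite (_ : v + a = v)//;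
    apply/matrixP => i [].
have mcA : measurable (@cons_rV R n @^-1` A).
  by rewrite -[X in measurable X]setTI; exact: measurable_cons_rV.
rewrite /= /lebesgue_cons /pushforward /product_measure1.
pose a' : 'rV[R]_n := \row_j a ord0 (lift ord0 j).
rewrite -[RHS](ge0_integral_shift (a ord0 ord0)); last 2 first.
- exact: (measurable_fun_xsection (lebesgue_rV R n) mcA).
- by move=> x; exact: measure_ge0.
apply: eq_integral => x _ /=.
rewrite -[RHS](IH a'); last exact: measurable_xsection.
congr (lebesgue_rV R _ _); apply/seteqP; split => v; rewrite /xsection/= !inE/=;
 (suff -> : cons_rV (x, v) + a = cons_rV (x + a ord0 ord0, v + a')%R by []);
 apply/rowP => i; case: (unliftP ord0 i) => [j|] ->; rewrite mxE ?cons_rV0 ?cons_rVS//= !mxE//.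
Qed.

Lemma negligible_shift n (a : 'rV[R]_n) (A : set 'rV[R]_n) :
  (lebesgue_rV R n).-negligible A ->
  (lebesgue_rV R n).-negligible ((fun v => v + a) @^-1` A).
Proof.
move=> [B [mB B0 AB]]; exists ((fun v => v + a) @^-1` B); split.
- by rewrite -[X in measurable X]setTI; exact: measurable_xshift.
- by rewrite lebesgue_rV_shift.
- by move=> x; exact: AB.
Qed.

End lebesgue_shift.

(** * The one-dimensional kernel and its transform *)

Section fejer_kernel.
Context (R : realType).
Local Notation leb := (@lebesgue_measure R).

(** The image of Lebesgue measure under multiplication by [c] is [c^-1] times Lebesgue measure,
    again by comparison on half-open intervals. *)
Lemma ge0_integral_scale (c : R) (f : measurableTypeR R -> \bar R) : 0 < c ->
  measurable_fun [set: measurableTypeR R] f -> (forall x, 0 <= f x)%E ->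
  (\int[leb]_x f (c * x)%R = c^-1%:E * \int[leb]_x f x)%E.
Proof.
move=> c0 mf f0; pose t : measurableTypeR R -> measurableTypeR R := fun x => (c * x)%R.
have mt : measurable_fun setT t.
  by apply: measurable_funM => //; exact: measurable_id.
have c1 : 0 <= c^-1 by rewrite invr_ge0 ltW.
have pE : forall A, measurable A -> mscale (NngNum c1) leb A = pushforward leb t A.
  suff H A : measurable A -> leb A = mscale (NngNum (ltW c0)) (pushforward leb t) A.
    move=> A mA; rewrite {1}/mscale/= H// /mscale/= muleA -EFinM mulVf ?gt_eqF//.
    by rewrite mul1e.
  move=> mA; apply: lebesgue_measure_unique mA => _ [[a b]] _ <-.
  have tE : t @^-1` `]a, b]%classic = `]c^-1 * a, c^-1 * b]%classic.
    by apply/seteqP; split => x /=; rewrite !in_itv/= /t ltr_pdivrMl// ler_pdivlMl.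
  rewrite -[RHS]/(c%:E * leb (t @^-1` `]a, b]%classic))%E tE.
  rewrite !lebesgue_measure_itv/= !lte_fin ltr_pM2l ?invr_gt0//.
  case: ifP => _; last by rewrite mule0.
  by rewrite -!EFinD -EFinM; congr EFin; rewrite mulrBr !mulVKf ?gt_eqF.
have := ge0_integral_pushforward mt leb measurableT mf (fun x _ => f0 x).
rewrite preimage_setT => <-.
transitivity (\int[mscale (NngNum c1) leb]_x f x)%E.
  by apply: eq_measure_integral => A mA _; exact/esym/pE.
by rewrite ge0_integral_mscale.
Qed.

(** Reflection preserves Lebesgue measure, so the integral equals its own opposite; integrability
    makes it finite, hence zero. *)
Lemma Rintegral_odd (f : measurableTypeR R -> R) :
  leb.-integrable [set: measurableTypeR R] (EFin \o f) ->
  (forall t, f (- t) = - f t) -> \int[leb]_t f t = 0.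
Proof.
move=> fi fodd; rewrite /Rintegral.
pose t : measurableTypeR R -> measurableTypeR R := -%R.
have mt : measurable_fun setT t by exact: oppr_measurable.
have fiN : leb.-integrable (t @^-1` setT) ((EFin \o f) \o t).
  rewrite preimage_setT.
  have -> : (EFin \o f) \o t = -%E \o (EFin \o f).
    by apply/funext => x /=; rewrite /t fodd.
  exact: integrableN.
have := integral_pushforward mt (measurable_int _ fi) fiN measurableT.
rewrite preimage_setT (_ : integral _ _ _ = \int[leb]_x (EFin \o f) x)%E; last first.
  by apply: eq_measure_integral => A mA _; exact: lebesgue_measureN.
have -> : (\int[leb]_x ((EFin \o f) \o t) x = - \int[leb]_x (EFin \o f) x)%E.
  rewrite -integralN; first by apply: eq_integral => x _ /=; rewrite /t fodd.
  exact: integrable_add_def.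
have := integrable_fin_num _ fi => /(_ measurableT).
case: (integral _ _ _) => //= r _ [].
by move=> /eqP; rewrite -addr_eq0 -mulr2n mulrn_eq0/= => /eqP.
Qed.

Lemma sin_abs_le (x : R) : `|sin x| <= `|x|.
Proof.
wlog x0 : x / 0 <= x => [h|].
  by have [/h//|/ltW x0] := leP 0 x; rewrite -normrN -sinN -(normrN x) h// oppr_ge0.
have csin : {within `[0, x], continuous (@sin R)}.
  by apply: continuous_subspaceT; exact: continuous_sin.
have [c _] := MVT_segment x0 (fun y _ => is_derive_sin y) csin.
rewrite sin0 !subr0 => ->; rewrite normrM ler_piMl//; exact: cos_max.
Qed.

Lemma one_sub_cosE (x : R) : 1 - cos x = sin (x / 2) ^+ 2 *+ 2.
Proof.
rewrite [in cos x](_ : x = (x / 2) *+ 2); last by rewrite -mulr_natr divfK.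
by rewrite cos_mulr2n cos2sin2; ring.
Qed.

(* By the convention [x / 0 = 0], [fejer s 0] is [0] and not the limit
   [2 * (pi * s) ^+ 2]; the point [0] is negligible. *)
Definition fejer (s t : R) : R := (1 - cos (2 * pi * s * t)) / t ^+ 2.

Lemma fejer_ge0 s t : 0 <= fejer s t.
Proof. by rewrite divr_ge0 ?sqr_ge0// subr_ge0 cos_le1. Qed.

Lemma fejerN s t : fejer s (- t) = fejer s t.
Proof. by rewrite /fejer mulrN cosN sqrrN. Qed.

Lemma fejerNl s t : fejer (- s) t = fejer s t.
Proof. by rewrite /fejer mulrN mulNr cosN. Qed.

Let B s : R := 2 + (2 * pi * s) ^+ 2 / 2.

Let B_ge0 s : 0 <= B s.
Proof. by rewrite addr_ge0// divr_ge0// sqr_ge0. Qed.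

(** After multiplication by [1 + t ^+ 2] there are two terms: [1 - cos u <= 2], and
    [(1 - cos u) / t ^+ 2] with [u = 2 * pi * s * t], where [1 - cos u = 2 * sin (u / 2) ^+ 2 <= u
    ^+ 2 / 2]. The majorant is integrable. *)
Lemma fejer_le s t : fejer s t <= (2 + (2 * pi * s) ^+ 2 / 2) / oneDsqr t.
Proof.
have o0 : 0 < oneDsqr t by rewrite (lt_le_trans ltr01)// oneDsqr_ge1.
rewrite ler_pdivlMr// /fejer.
have [->|t0] := eqVneq t 0.
  by rewrite expr0n/= invr0 mulr0 mul0r; exact: B_ge0.
rewrite /oneDsqr mulrDr mulr1 divfK ?sqrf_eq0// addrC lerD//.
  by have := cos_geN1 (2 * pi * s * t); lra.
rewrite ler_pdivrMr ?exprn_even_gt0// one_sub_cosE.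
rewrite (_ : _ / 2 * _ = (2 * pi * s * t / 2) ^+ 2 *+ 2); last by field.
rewrite lerMn2r/= -[leLHS]real_normK ?num_real// -[leRHS]real_normK ?num_real//.
by rewrite lerXn2r ?nnegrE// sin_abs_le.
Qed.

Lemma measurable_fejer s : measurable_fun [set: R] (fejer s).
Proof.
apply: measurable_funM.
  apply: measurable_funB => //; apply: continuous_measurable_fun => x.
  apply: continuous_comp; last exact: continuous_cos.
  exact: mulrl_continuous.
(* The inverse square is written as a real power of [t ^+ 2]; at 0 both sides are 0 by
   convention. *)
rewrite (_ : (fun _ => _) = (@powR R ^~ (-1)) \o (fun t : R => t ^+ 2)); last first.
  by apply/funext => t /=; rewrite powR_inv1// sqr_ge0.
apply: measurableT_comp; first exact: measurable_powR.
exact: exprn_measurable.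
Qed.

(** The function is even, and its integral over the half line is the known arctangent integral. *)
Lemma integrable_oneDsqrV :
  leb.-integrable [set: R] (EFin \o (fun t => (oneDsqr t)^-1)).
Proof.
apply/integrableP; split.
  have mV : measurable_fun [set: R] (fun t : R => (oneDsqr t)^-1).
    by apply: continuous_measurable_fun => x; exact: continuous_oneDsqrV.
  exact: ((measurable_EFinP _ _).2 mV).
under eq_integral => x _ do rewrite /= ger0_norm ?invr_ge0// ?(le_trans ler01) ?oneDsqr_ge1//.
rewrite ge0_symfun_integralT.
- rewrite -set_itvcy integral0y_oneDsqr -EFinM; exact: ltry.
- by move=> x; rewrite invr_ge0 (le_trans ler01)// oneDsqr_ge1.
- exact: continuous_oneDsqrV.
- by move=> x /=; rewrite /oneDsqr sqrrN.
Qed.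

Lemma integrable_fejerM s (h : measurableTypeR R -> R) :
  measurable_fun [set: measurableTypeR R] h -> (forall t, `|h t| <= 1) ->
  leb.-integrable [set: measurableTypeR R] (EFin \o (fun t => fejer s t * h t)).
Proof.
move=> mh h1; apply: (le_integrable _ _ _ (integrableZl _ (B s) integrable_oneDsqrV)) => //.
  by apply/measurable_EFinP; apply: measurable_funM => //; exact: measurable_fejer.
move=> t _ /=; rewrite lee_fin normrM (ger0_norm (fejer_ge0 s t)).
rewrite (le_trans (ler_piMr (fejer_ge0 s t) (h1 t)))//.
by rewrite (le_trans (fejer_le s t))// ler_norm.
Qed.

Lemma integrable_fejer s :
  leb.-integrable [set: measurableTypeR R] (EFin \o fejer s).
Proof.
rewrite (_ : fejer s = fun t => fejer s t * 1); last first.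
  by apply/funext => t; rewrite mulr1.
by apply: (@integrable_fejerM s (cst 1)) => //= t; rewrite normr1.
Qed.

Definition fejer_mass : R := \int[leb]_t fejer 1 t.

(* [fejer s t = s ^+ 2 * fejer 1 (s * t)], and substituting [s * t] divides the
   integral by [s]. The value [pi ^+ 2 * 2] of [fejer_mass] is never needed. *)
Lemma Rintegral_fejer s : \int[leb]_t fejer s t = `|s| * fejer_mass.
Proof.
wlog s0 : s / 0 <= s => [h|].
  have [/h//|/ltW s0] := leP 0 s.
  rewrite -normrN -h ?oppr_ge0//; apply: eq_Rintegral => t _.
  by rewrite fejerNl.
rewrite ger0_norm//; move: s0; rewrite le_eqVlt => /predU1P[<-|s0].
  rewrite mul0r (_ : fejer 0 = cst 0) ?Rintegral_cst// ?mul0r//.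
  by apply/funext => t; rewrite /fejer mulr0 mul0r cos0 subrr mul0r.
have fE t : fejer s t = s ^+ 2 * fejer 1 (s * t).
  rewrite /fejer mulr1 (mulrA (2 * pi) s t) exprMn [(s ^+ 2 * _)^-1]invfM.
  by rewrite [RHS]mulrCA mulVKf// sqrf_eq0 gt_eqF.
under eq_Rintegral do rewrite fE.
rewrite /fejer_mass /Rintegral.
under eq_integral do rewrite EFinM.
have mf : measurable_fun [set: measurableTypeR R] (EFin \o fejer 1).
  exact: measurable_int (integrable_fejer 1).
rewrite ge0_integralZl//; last 3 first.
- have := measurable_int _ (integrable_fejer s).
  have -> : EFin \o fejer s = fun x => ((s ^+ 2)%:E * (fejer 1 (s * x))%:E)%E.
    by apply/funext => t /=; rewrite fE EFinM.
  move=> /(measurable_funeM (s ^- 2)%:E).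
  apply: eq_measurable_fun => t _ /=.
  by rewrite muleA -EFinM mulVf ?mul1r// expf_neq0 ?gt_eqF.
- by move=> t _; rewrite lee_fin fejer_ge0.
- by rewrite lee_fin sqr_ge0.
rewrite (ge0_integral_scale s0 mf)/=; last by move=> t; rewrite lee_fin fejer_ge0.
have := integrable_fin_num measurableT (integrable_fejer 1).
move=> /fineK <-; rewrite -!EFinM [LHS]/= mulrA; congr (_ * _).
by rewrite expr2 mulfK// gt_eqF.
Qed.

(** For [t] between 1/4 and 1/2 the angle [2 * pi * t] lies between [pi / 2] and [pi], so its cosine
    is at most 0; as [t ^+ 2 <= 1], the kernel is at least 1 on an interval of length 1/4. *)
Lemma fejer_mass_gt0 : 0 < fejer_mass.
Proof.
have mI : measurable (`[4^-1, 2^-1]%classic : set (measurableTypeR R)).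
  exact: measurable_itv.
have i1 := integrable_fejer 1.
rewrite lt_neqAle Rintegral_ge0 ?andbT; last by move=> t _; exact: fejer_ge0.
apply/eqP => m0.
suff : (\int[leb]_(t in `[4^-1%R, 2^-1%R]) cst 1%:E t <= 0)%E.
  rewrite integral_cst// mul1e -[X in (X <= _)%E]/(leb `[4^-1, 2^-1]%classic).
  rewrite lebesgue_measure_itv/= lte_fin ifT; last by lra.
  by rewrite lee_fin; lra.
have -> : 0%E = (\int[leb]_t (fejer 1 t)%:E)%E.
  by rewrite -(fineK (integrable_fin_num measurableT i1)) -[fine _]/fejer_mass -m0.
apply: (@le_trans _ _ (\int[leb]_(t in `[4^-1%R, 2^-1%R]) (fejer 1 t)%:E)%E); last first.
  apply: ge0_subset_integral => //; first exact: measurable_int i1.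
  by move=> t _; rewrite lee_fin fejer_ge0.
apply: le_ge0_integral => //= t; rewrite in_itv/= => /andP[t4 t2].
have t0 : 0 < t by rewrite (lt_le_trans _ t4)// invr_gt0.
rewrite lee_fin /fejer ler_pdivlMr ?exprn_gt0// mul1r mulr1.
have c0 : cos (2 * pi * t) <= 0.
  rewrite -cos_pihalf -[leLHS]/(cos _) leNgt ltr_cos ?in_itv/= -?leNgt;
    have := @pi_gt0 R; nra.
have : t ^+ 2 <= 1 by rewrite expr_le1//; lra.
lra.
Qed.

(** For [s > 0], a triangle supported where [|y| <= s], of height [s * fejer_mass]. The form with
    absolute values is the one that results from adding three integrals of [fejer]. *)
Definition tent (s y : R) : R :=
  ((`|y + s| + `|y - s|) / 2 - `|y|) * fejer_mass.

Lemma fejer_cos s y t : fejer s t * cos (2 * pi * (t * y)) =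
  fejer (y + s) t / 2 + fejer (y - s) t / 2 - fejer y t.
Proof.
rewrite /fejer [2 * pi * (t * y)](_ : _ = 2 * pi * y * t); last by ring.
rewrite (_ : 2 * pi * (y + s) * t = 2 * pi * y * t + 2 * pi * s * t); last by ring.
rewrite (_ : 2 * pi * (y - s) * t = 2 * pi * y * t - 2 * pi * s * t); last by ring.
(* With the inverse square abstracted, the identity needs no case distinction at [t = 0]. *)
rewrite cosD cosB; move: (t ^+ 2)^-1 => v; by field.
Qed.

Lemma Rintegral_fejer_cos s y :
  \int[leb]_t (fejer s t * cos (2 * pi * (t * y))) = tent s y.
Proof.
under eq_Rintegral do rewrite fejer_cos.
have H a : leb.-integrable [set: measurableTypeR R] (EFin \o (fun t => fejer a t / 2)).
  rewrite (_ : _ \o _ = (fun t => (2^-1)%:E * (fejer a t)%:E)%E); last first.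
    by apply/funext => t /=; rewrite -EFinM mulrC.
  by apply: integrableZl => //; exact: integrable_fejer.
rewrite RintegralB//=; [|exact: (integrableD measurableT (H _) (H _))|exact: integrable_fejer].
rewrite RintegralD// !RintegralZr//; [|exact: integrable_fejer..].
by rewrite !Rintegral_fejer /tent mulrBl mulrDl mulrDl; congr (_ + _ - _); rewrite mulrAC.
Qed.

Lemma Rintegral_fejer_sin s y :
  \int[leb]_t (fejer s t * sin (2 * pi * (t * y))) = 0.
Proof.
apply: Rintegral_odd; last by move=> t; rewrite fejerN mulNr mulrN sinN mulrN.
apply: integrable_fejerM; last by move=> t; exact: sin_max.
apply: continuous_measurable_fun => t.
apply: continuous_comp; last exact: continuous_sin.
apply: continuous_comp; last exact: mulrl_continuous.
exact: mulrr_continuous.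
Qed.

Lemma tent_eq0 s y : 0 < s -> s <= `|y| -> tent s y = 0.
Proof.
move=> s0 sy; rewrite /tent; apply/eqP; rewrite mulf_eq0; apply/orP; left; apply/eqP.
by move: sy; case: (ger0P y) => ? ?; case: (ger0P (y + s)) => ?;
  case: (ger0P (y - s)) => ?; lra.
Qed.

Lemma tentE s y : `|y| <= s -> tent s y = (s - `|y|) * fejer_mass.
Proof.
rewrite ler_norml => /andP[sy ys]; rewrite /tent; congr (_ * _).
rewrite (ger0_norm (_ : 0 <= y + s)); last by lra.
by rewrite (ler0_norm (_ : y - s <= 0)); lra.
Qed.

End fejer_kernel.

(** * Integrals of products of one-variable functions *)

Section product_functions.
Context (R : realType).
Local Notation leb := (@lebesgue_measure R).

Definition behead_rV n (v : 'rV[R]_n.+1) : 'rV[R]_n := \row_j v ord0 (lift ord0 j).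

Lemma behead_cons_rV n (x : R) (v : 'rV[R]_n) : behead_rV (cons_rV (x, v)) = v.
Proof. by apply/rowP => j; rewrite mxE cons_rVS. Qed.

Lemma measurable_behead_rV n : measurable_fun [set: 'rV[R]_n.+1] (@behead_rV n).
Proof.
apply: (measurability (@open 'rV[R]_n)) => // _ [U oU <-].
rewrite setTI; apply: open_measurable_rV; apply: open_comp => // v _.
move=> A /nbhs_ballP[e /= e0 eA]; apply/nbhs_ballP; exists e => //= w [_ vw].
by apply: eA; split => // i j; rewrite !mxE; exact: vw.
Qed.

Section cons_mul.
Context (n : nat) (f : measurableTypeR R -> R) (h : 'rV[R]_n -> R).
Hypothesis fi : leb.-integrable [set: measurableTypeR R] (EFin \o f).
Hypothesis hi : (lebesgue_rV R n).-integrable [set: 'rV[R]_n] (EFin \o h).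

Let F (v : 'rV[R]_n.+1) := f (v ord0 ord0) * h (behead_rV v).

Let mf : measurable_fun [set: measurableTypeR R] f.
Proof. by apply/measurable_EFinP; exact: measurable_int fi. Qed.

Let mh : measurable_fun [set: 'rV[R]_n] h.
Proof. by apply/measurable_EFinP; exact: measurable_int hi. Qed.

Let mF : measurable_fun [set: 'rV[R]_n.+1] F.
Proof.
apply: measurable_funM.
  exact: (measurableT_comp mf (measurable_coord_rV ord0)).
exact: (measurableT_comp mh (@measurable_behead_rV n)).
Qed.

Let FE q : F (cons_rV q) = f q.1 * h q.2.
Proof. by case: q => x v; rewrite /F cons_rV0 behead_cons_rV. Qed.

(** By Tonelli it is enough that the iterated integral of the absolute value is finite, and this is
    the product of two finite integrals. *)
Let prod_integrable :
  (leb \x lebesgue_rV R n)%E.-integrable setT ((EFin \o F) \o @cons_rV R n).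
Proof.
apply/integrable12ltyP.
  apply: measurableT_comp; last exact: measurable_cons_rV.
  exact/measurable_EFinP.
have If : (\int[leb]_x `|(f x)%:E| < +oo)%E by case/integrableP : fi.
have Ih : (\int[lebesgue_rV R n]_x `|(h x)%:E| < +oo)%E by case/integrableP : hi.
under eq_integral => x _.
  under eq_integral => y _ do rewrite /= FE normrM EFinM /=.
  rewrite ge0_integralZl//; last first.
    by apply/measurable_EFinP; exact: measurableT_comp.
  over.
rewrite ge0_integralZr//; last 2 first.
- by apply/measurable_EFinP; exact: measurableT_comp.
- exact: integral_ge0.
apply: lte_mul_pinfty => //; first exact: integral_ge0.
by rewrite ge0_fin_numE//; exact: integral_ge0.
Qed.

Lemma integrable_cons_mul :
  (lebesgue_rV R n.+1).-integrable [set: 'rV[R]_n.+1]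
    (EFin \o (fun v : 'rV[R]_n.+1 => f (v ord0 ord0) * h (behead_rV v))).
Proof.
apply: (integrable_pushforward (@measurable_cons_rV R n)) => //.
  exact/measurable_EFinP.
Qed.

(** The measure in dimension [n.+1] is the image of a product measure, so a change of variables
    followed by Fubini separates the factors. *)
Lemma Rintegral_cons_mul :
  \int[lebesgue_rV R n.+1]_v (f ((v : 'rV[R]_n.+1) ord0 ord0) * h (behead_rV v)) =
  (\int[leb]_x f x) * (\int[lebesgue_rV R n]_v h v).
Proof.
rewrite /Rintegral.
have -> : (\int[lebesgue_rV R n.+1]_x (f (x ord0 ord0) * h (behead_rV x))%:E =
   \int[(leb \x lebesgue_rV R n)]_q (((EFin \o F) \o @cons_rV R n) q))%E.
  apply: (integral_pushforward (@measurable_cons_rV R n)) => //.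
  exact/measurable_EFinP.
rewrite -integral12_prod_meas1// /fubini_F.
transitivity (fine (\int[leb]_x ((f x)%:E * \int[lebesgue_rV R n]_y (h y)%:E)%E)).
  congr fine; apply: eq_integral => x _; rewrite -integralZl//.
  by apply: eq_integral => y _; rewrite /= FE EFinM.
rewrite -(fineK (integrable_fin_num measurableT hi)) integralZr//.
by rewrite -(fineK (integrable_fin_num measurableT fi)).
Qed.

End cons_mul.

Lemma integrable_prod_rV n (f : 'I_n -> measurableTypeR R -> R) :
  (forall i, leb.-integrable [set: measurableTypeR R] (EFin \o f i)) ->
  (lebesgue_rV R n).-integrable [set: 'rV[R]_n]
    (EFin \o (fun v : 'rV[R]_n => \prod_i f i (v ord0 i))).
Proof.
elim: n f => [f _|n IH f fi].
  rewrite (_ : _ \o _ = cst 1%E); last by apply/funext => v /=; rewrite big_ord0.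
  exact: finite_measure_integrable_cst.
rewrite (_ : _ \o _ = EFin \o (fun v : 'rV[R]_n.+1 => f ord0 (v ord0 ord0) *
    (fun w : 'rV[R]_n => \prod_i f (lift ord0 i) (w ord0 i)) (behead_rV v))).
  exact: (integrable_cons_mul (fi ord0) (IH _ (fun i => fi (lift ord0 i)))).
apply/funext => v /=; congr EFin; rewrite big_ord_recl; congr (_ * _).
by apply: eq_bigr => i _; rewrite mxE.
Qed.

End product_functions.

(** * A test function with a compactly supported transform *)

Section test_function.
Context (R : realType).
Local Notation leb := (@lebesgue_measure R).
Local Notation mu n := (lebesgue_rV R n).

Lemma measurable_dot n (y : 'rV[R]_n) : measurable_fun [set: 'rV[R]_n] (fun x => dot x y).
Proof.
apply: measurable_sum => i; apply: measurable_funM => //.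
exact: (measurable_coord_rV i).
Qed.

Lemma measurable_trig n (h : R -> R) (y : 'rV[R]_n) : continuous h ->
  measurable_fun [set: 'rV[R]_n] (fun x => h (2 * pi * dot x y)).
Proof.
move=> ch; have mh := continuous_measurable_fun ch.
apply: (measurableT_comp mh); apply: measurable_funM => //.
exact: measurable_dot.
Qed.

Lemma dot_behead n (x y : 'rV[R]_n.+1) :
  dot x y = x ord0 ord0 * y ord0 ord0 + dot (behead_rV x) (behead_rV y).
Proof.
by rewrite /dot big_ord_recl; congr (_ + _); apply: eq_bigr => i _; rewrite !mxE.
Qed.

Lemma dotB n (x y z : 'rV[R]_n) : dot x (y - z) = dot x y - dot x z.
Proof.
by rewrite /dot -sumrB; apply: eq_bigr => i _; rewrite !mxE mulrBr.
Qed.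

Definition fejer_rV n s (x : 'rV[R]_n) : R := \prod_i fejer s (x ord0 i).

Lemma fejer_rV_ge0 n s (x : 'rV[R]_n) : 0 <= fejer_rV s x.
Proof. by apply: prodr_ge0 => i _; exact: fejer_ge0. Qed.

Lemma integrable_fejer_rV n s :
  (mu n).-integrable [set: 'rV[R]_n] (EFin \o @fejer_rV n s).
Proof. exact: (integrable_prod_rV (f := fun=> fejer s) (fun=> integrable_fejer s)). Qed.

Lemma measurable_fejer_rV n s : measurable_fun [set: 'rV[R]_n] (@fejer_rV n s).
Proof. by apply/measurable_EFinP; exact: measurable_int (integrable_fejer_rV n s). Qed.

Lemma integrable_fejer_rVM n s (h : 'rV[R]_n -> R) :
  measurable_fun [set: 'rV[R]_n] h -> (forall x, `|h x| <= 1) ->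
  (mu n).-integrable [set: 'rV[R]_n] (EFin \o (fun x => fejer_rV s x * h x)).
Proof.
move=> mh h1; apply: (le_integrable _ _ _ (integrable_fejer_rV n s)) => //.
  by apply/measurable_EFinP; apply: measurable_funM => //; exact: measurable_fejer_rV.
by move=> x _ /=; rewrite lee_fin normrM ler_piMr.
Qed.

(** Induction on the dimension, for both integrals at once because the addition formulas mix them.
    Every product containing a sine integral vanishes, which leaves only the product of the cosine
    integrals. *)
Lemma Rintegral_fejer_rV_trig n s (y : 'rV[R]_n) :
  \int[mu n]_x (fejer_rV s x * cos (2 * pi * dot x y)) = \prod_i tent s (y ord0 i) /\
  \int[mu n]_x (fejer_rV s x * sin (2 * pi * dot x y)) = 0.
Proof.
elim: n y => [|n IH] y.
  have d0 (x : 'rV[R]_0) : dot x y = 0 by rewrite /dot big_ord0.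
  rewrite big_ord0; split.
    under eq_Rintegral do rewrite d0 mulr0 cos0 mulr1 /fejer_rV big_ord0.
    rewrite Rintegral_cst// mul1r -[X in fine X]/(@dirac _ 'rV[R]_0 0 R setT).
    by rewrite diracE mem_set.
  under eq_Rintegral do rewrite d0 mulr0 sin0 mulr0.
  by rewrite Rintegral_cst// mul0r.
have FE (v : 'rV[R]_n.+1) : fejer_rV s v =
    fejer s (v ord0 ord0) * fejer_rV s (behead_rV v).
  rewrite /fejer_rV big_ord_recl; congr (_ * _).
  by apply: eq_bigr => i _; rewrite mxE.
have [IHc IHs] := IH (behead_rV y).
pose y0 := y ord0 ord0.
have mh h : continuous h -> measurable_fun [set: measurableTypeR R]
    (fun t : R => h (2 * pi * (t * y0)) : R).
  move=> ch; apply: continuous_measurable_fun => t.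
  apply: continuous_comp; last exact: ch.
  apply: continuous_comp; last exact: mulrl_continuous.
  exact: mulrr_continuous.
have ic : leb.-integrable [set: measurableTypeR R]
    (EFin \o (fun t => fejer s t * cos (2 * pi * (t * y0)))).
  by apply: integrable_fejerM; [exact: (mh _ (@continuous_cos R))|move=> t; exact: cos_max].
have is_ : leb.-integrable [set: measurableTypeR R]
    (EFin \o (fun t => fejer s t * sin (2 * pi * (t * y0)))).
  by apply: integrable_fejerM; [exact: (mh _ (@continuous_sin R))|move=> t; exact: sin_max].
have Ic : (mu n).-integrable [set: 'rV[R]_n]
    (EFin \o (fun x => fejer_rV s x * cos (2 * pi * dot x (behead_rV y)))).
  apply: integrable_fejer_rVM; last by move=> x; exact: cos_max.
  exact: (measurable_trig _ (@continuous_cos R)).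
have Is : (mu n).-integrable [set: 'rV[R]_n]
    (EFin \o (fun x => fejer_rV s x * sin (2 * pi * dot x (behead_rV y)))).
  apply: integrable_fejer_rVM; last by move=> x; exact: sin_max.
  exact: (measurable_trig _ (@continuous_sin R)).
split.
  under eq_Rintegral.
    move=> v _; rewrite FE dot_behead mulrDr cosD mulrBr mulrACA.
    rewrite [X in _ - X]mulrACA; over.
  rewrite RintegralB//; [|exact: (integrable_cons_mul ic Ic)
                        |exact: (integrable_cons_mul is_ Is)].
  rewrite (Rintegral_cons_mul ic Ic) (Rintegral_cons_mul is_ Is).
  rewrite Rintegral_fejer_cos IHc IHs mulr0 subr0 big_ord_recl; congr (_ * _).
  by apply: eq_bigr => i _; rewrite mxE.
under eq_Rintegral.
  move=> v _; rewrite FE dot_behead mulrDr sinD mulrDr mulrACA.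
  rewrite [X in _ + X]mulrACA; over.
rewrite RintegralD//; [|exact: (integrable_cons_mul is_ Ic)
                      |exact: (integrable_cons_mul ic Is)].
rewrite (Rintegral_cons_mul is_ Ic) (Rintegral_cons_mul ic Is).
by rewrite Rintegral_fejer_sin IHs mul0r mulr0 addr0.
Qed.

Lemma Lp1_integrable n (f : 'rV[R]_n -> R[i]) : cmeasurable f ->
  (mu n).-integrable [set: 'rV[R]_n] (EFin \o (fun x => normc (f x))) -> Lp 1%:E f.
Proof.
move=> mf /integrableP[_ fi]; split => //.
by rewrite /cLnorm Lnorm1.
Qed.

Lemma Lp2_integrable n (f : 'rV[R]_n -> R[i]) : cmeasurable f ->
  (mu n).-integrable [set: 'rV[R]_n] (EFin \o (fun x => normc (f x) ^+ 2)) ->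
  Lp 2%:E f.
Proof.
move=> mf /integrableP[_ fi]; split => //.
rewrite /cLnorm unlock /Lnorm; apply: poweR_lty.
apply: le_lt_trans fi; rewrite le_eqVlt; apply/orP; left; apply/eqP.
apply: eq_integral => x _ /=.
by rewrite normrX powR_mulrn.
Qed.

Lemma normc_real (r : R) : normc (r%:C)%C = `|r|.
Proof. by rewrite /normc/= expr0n/= addr0 sqrtr_sqr. Qed.

Lemma normc_expi (t : R) : normc (expi t) = 1.
Proof. by rewrite /normc/= cos2Dsin2 sqrtr1. Qed.

Lemma expiD (t u : R) : expi (t + u) = expi t * expi u.
Proof.
apply/eqP; rewrite eq_complex/= cosD sinD eqxx/=.
by rewrite addrC.
Qed.

Section wave.
Context (n : nat) (s : R) (s0 : 0 < s) (b : 'rV[R]_n).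

(** Modulation by the character of frequency [b] moves the centre of the transform from the origin
    to [b]; the transform is then [bump]. *)
Definition wave (x : 'rV[R]_n) : R[i] :=
  (fejer_rV s x)%:C%C * expi (2 * pi * dot x b).

Definition bump (w : 'rV[R]_n) : R := \prod_i tent s (b ord0 i - w ord0 i).

Lemma normc_wave x : normc (wave x) = fejer_rV s x.
Proof.
by rewrite normcM normc_expi mulr1 normc_real ger0_norm// fejer_rV_ge0.
Qed.

Lemma ReM_real (a : R) (z : R[i]) : complex.Re (a%:C%C * z) = a * complex.Re z.
Proof. by case: z => x y /=; rewrite mul0r subr0. Qed.

Lemma ImM_real (a : R) (z : R[i]) : complex.Im (a%:C%C * z) = a * complex.Im z.
Proof. by case: z => x y /=; rewrite mul0r addr0. Qed.

Lemma cmeasurable_wave : cmeasurable wave.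
Proof.
split.
  under eq_fun do rewrite ReM_real /=.
  apply: measurable_funM; first exact: measurable_fejer_rV.
  exact: (measurable_trig _ (@continuous_cos R)).
under eq_fun do rewrite ImM_real /=.
apply: measurable_funM; first exact: measurable_fejer_rV.
exact: (measurable_trig _ (@continuous_sin R)).
Qed.

Lemma Lp1_wave : Lp 1%:E wave.
Proof.
apply: Lp1_integrable; first exact: cmeasurable_wave.
under eq_fun do rewrite normc_wave.
exact: integrable_fejer_rV.
Qed.

Lemma fejer_bounded : exists2 M : R, 0 < M & forall t, fejer s t <= M.
Proof.
exists (2 + (2 * pi * s) ^+ 2 / 2).
  by rewrite (lt_le_trans (ltr0n _ 2))// lerDl divr_ge0// sqr_ge0.
move=> t; apply: (le_trans (fejer_le s t)); rewrite ler_piMr//.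
  by rewrite addr_ge0// divr_ge0// sqr_ge0.
by rewrite invf_le1 ?oneDsqr_ge1// (lt_le_trans ltr01)// oneDsqr_ge1.
Qed.

(** The kernel is bounded by some [M], so its square is at most [M] times the integrable kernel. *)
Lemma integrable_fejer_sqr :
  leb.-integrable [set: measurableTypeR R] (EFin \o (fun t => fejer s t ^+ 2)).
Proof.
have [M M0 fM] := fejer_bounded.
apply: (le_integrable _ _ _ (integrableZl _ M (integrable_fejer s))) => //.
  by apply/measurable_EFinP; apply: measurable_funX; exact: measurable_fejer.
move=> t _ /=; rewrite lee_fin (ger0_norm (sqr_ge0 _)).
rewrite (ger0_norm (mulr_ge0 (ltW M0) (fejer_ge0 s t))).
by rewrite expr2 ler_wpM2r// fejer_ge0.
Qed.

Lemma Lp2_wave : Lp 2%:E wave.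
Proof.
apply: Lp2_integrable; first exact: cmeasurable_wave.
under eq_fun do rewrite normc_wave -prodrXl.
exact: (integrable_prod_rV (f := fun _ t => fejer s t ^+ 2)
  (fun=> integrable_fejer_sqr)).
Qed.

Lemma tent_ge0 y : 0 <= tent s y.
Proof.
have [ys|/ltW ys] := leP `|y| s; last by rewrite tent_eq0.
by rewrite tentE// mulr_ge0 ?subr_ge0// ltW// fejer_mass_gt0.
Qed.

Lemma tent_le y : tent s y <= s * fejer_mass R.
Proof.
have m0 := ltW (fejer_mass_gt0 R).
have [ys|/ltW ys] := leP `|y| s; last by rewrite tent_eq0// mulr_ge0// ltW.
by rewrite tentE// ler_wpM2r// gerBl.
Qed.

Lemma measurable_tentB c : measurable_fun [set: measurableTypeR R]
  (fun t : R => tent s (c - t)).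
Proof.
have mB (a : R) : measurable_fun [set: measurableTypeR R] (fun t : R => `|c - t + a|).
  apply: measurableT_comp => //; apply: measurable_funD => //.
  by apply: measurable_funB => //; exact: measurable_id.
apply: measurable_funM => //; apply: measurable_funB.
  by apply: measurable_funM => //; apply: measurable_funD; exact: mB.
by have := mB 0; under eq_fun do rewrite addr0.
Qed.

(** Domination by the squared height of the tent on the interval of radius [s] around [c], outside
    which the function is zero. *)
Lemma integrable_tent_sqr c :
  leb.-integrable [set: measurableTypeR R] (EFin \o (fun t => tent s (c - t) ^+ 2)).
Proof.
pose M := (s * fejer_mass R) ^+ 2.
have iI := integrable_indic_itv (c - s) (c + s) true false.
apply: (le_integrable _ _ _ (integrableZl _ M iI)) => //.
  by apply/measurable_EFinP; apply: measurable_funX; exact: measurable_tentB.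
move=> t _ /=; rewrite lee_fin (ger0_norm (sqr_ge0 _)) (le_trans _ (ler_norm _))//.
have [ts|ts] := leP `|c - t| s; last first.
  by rewrite (tent_eq0 s0 (ltW ts)) expr0n/= mulr_ge0// sqr_ge0.
rewrite indicE mem_set ?mulr1; last first.
  by rewrite /= in_itv/=; move: ts; rewrite ler_distlC andbC.
by rewrite lerXn2r ?nnegrE ?tent_ge0 ?tent_le// (le_trans (tent_ge0 0) (tent_le 0)).
Qed.

Lemma bump_ge0 w : 0 <= bump w.
Proof. by apply: prodr_ge0 => i _; exact: tent_ge0. Qed.

Lemma bump_le w : bump w <= (s * fejer_mass R) ^+ n.
Proof.
rewrite -[X in _ ^+ X]card_ord -prodr_const; apply: ler_prod => i _.
by rewrite tent_ge0 tent_le.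
Qed.

Lemma bump_ge (w : 'rV[R]_n) (r : R) : 0 <= r <= s -> (forall i, `|b ord0 i - w ord0 i| <= r) ->
  ((s - r) * fejer_mass R) ^+ n <= bump w.
Proof.
move=> /andP[r0 rs] bw; rewrite -[X in _ ^+ X]card_ord -prodr_const; apply: ler_prod => i _.
have m0 := ltW (fejer_mass_gt0 R).
rewrite mulr_ge0 ?subr_ge0//= tentE ?(le_trans (bw i))//.
by rewrite ler_wpM2r// lerB.
Qed.

Lemma bump_eq0 (w : 'rV[R]_n) i : s <= `|b ord0 i - w ord0 i| -> bump w = 0.
Proof. by move=> h; rewrite /bump (bigD1 i)//= tent_eq0// mul0r. Qed.

Lemma measurable_bump : measurable_fun [set: 'rV[R]_n] bump.
Proof.
apply: measurable_prod => i _.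
exact: (measurableT_comp (measurable_tentB (b ord0 i)) (measurable_coord_rV i)).
Qed.

Lemma normc_bump w : normc (bump w)%:C%C = bump w.
Proof. by rewrite normc_real ger0_norm// bump_ge0. Qed.

Lemma Lp2_bump : Lp 2%:E (fun w => (bump w)%:C%C).
Proof.
apply: Lp2_integrable; first by split => //=; exact: measurable_bump.
under eq_fun do rewrite normc_bump -prodrXl.
by apply: (@integrable_prod_rV _ _ (fun i t => tent s (b ord0 i - t) ^+ 2)) => i;
  exact: integrable_tent_sqr.
Qed.

(** The two exponentials combine into one of frequency [b - w]; its cosine integral is the product
    of tents and its sine integral is zero. *)
Lemma fourier_wave : fourier_L1 wave = fun w => (bump w)%:C%C.
Proof.
apply/funext => w.
have E x : wave x * expi (- (2 * pi * dot x w)) =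
    (fejer_rV s x)%:C%C * expi (2 * pi * dot x (b - w)).
  by rewrite /wave -mulrA -expiD dotB mulrBr.
have [c0 s1] := Rintegral_fejer_rV_trig s (b - w).
transitivity (cintegral (fun x => (fejer_rV s x)%:C%C * expi (2 * pi * dot x (b - w)))).
  by congr cintegral; apply/funext => x; exact: E.
rewrite /cintegral -[RHS]/(bump w +i* 0)%C; congr (Complex _ _).
  under eq_Rintegral do rewrite ReM_real/=.
  by rewrite c0; apply: eq_bigr => i _; rewrite !mxE.
by under eq_Rintegral do rewrite ImM_real/=.
Qed.

(** Since [wave] lies in both [L^1] and [L^2], the constant sequence is an admissible approximation
    and all the norms to be controlled are zero. *)
Lemma plancherel_wave : plancherel wave (fun w => (bump w)%:C%C).
Proof.
split; [exact: Lp2_wave|exact: Lp2_bump|].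
have N0 (f : 'rV[R]_n -> R[i]) : cLnorm 2%:E (f \- f) = 0%E.
  rewrite /cLnorm (_ : (fun x => _) = cst 0%E) ?Lnorm0//.
  by apply/funext => x /=; rewrite subrr normc0.
exists (fun _ => wave); split; first by move=> _; split; [exact: Lp1_wave|exact: Lp2_wave].
  by rewrite N0; exact: cvg_cst.
by rewrite fourier_wave N0; exact: cvg_cst.
Qed.

Lemma bump_bounded : (cLnorm +oo (fun w => (bump w)%:C%C) < +oo)%E.
Proof.
rewrite /cLnorm unlock; case: ifP => _; last exact: ltry.
apply: (@le_lt_trans _ _ ((s * fejer_mass R) ^+ n)%:E); last exact: ltry.
apply/ess_supP/nearW => w.
rewrite -[leLHS]/(`|normc (bump w)%:C%C|%:E) normc_bump ger0_norm ?bump_ge0// lee_fin.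
exact: bump_le.
Qed.

End wave.
End test_function.

(** * Essential supports *)

Section ess_supp_theory.
Context (R : realType) (n : nat).
Local Notation mu := (lebesgue_rV R n).

Lemma closed_measurable_rV (A : set 'rV[R]_n) : closed A -> measurable A.
Proof.
move=> cA; rewrite -(setCK A); apply: measurableC; apply: open_measurable_rV.
exact: closed_openC.
Qed.

Lemma compact_measurable_rV (A : set 'rV[R]_n) : compact A -> measurable A.
Proof.
move=> cA; apply: closed_measurable_rV.
exact: (compact_closed (@norm_hausdorff _ _) cA).
Qed.

(** In the sup norm a ball is a box, whose sides here have length [2 * e]. *)
Lemma lebesgue_rV_ball_gt0 (x : 'rV[R]_n) (e : R) : 0 < e -> (0 < mu (ball x e))%E.
Proof.
move=> e0; rewrite (_ : ball x e = boxR (fun i => ball (x ord0 i) e)); last first.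
  apply/seteqP; split => v; first by move=> [_ xv] i; exact: xv.
  by move=> xv; split => // i j; rewrite (ord1 i).
rewrite lebesgue_rV_box; last by move=> i; exact: measurable_ball.
elim/big_ind : _ => //; first by move=> a b a0 b0; rewrite mule_gt0.
by move=> i _; rewrite lebesgue_measure_ball ?ltW// lte_fin mulrn_wgt0.
Qed.

(** A neighbourhood that witnesses that a point is outside the support is also a neighbourhood of
    all nearby points. *)
Lemma ess_supp_closed (f : 'rV[R]_n -> R[i]) : closed (ess_supp f).
Proof.
rewrite -[X in closed X]setCK; apply: open_closedC.
rewrite openE => x /= /existsNP[U /not_implyP[Ux /contrapT Uf]].
have {}Ux := nbhs_interior Ux.
rewrite /interior; near=> y => /= /(_ U) []//.
by near: y; exact: Ux.
Unshelve. all: end_near. Qed.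

Lemma rat_balls_basis (x : 'rV[R]_n) (U : set 'rV[R]_n) : nbhs x U ->
  exists q : 'rV[rat]_n * nat,
    ball (map_mx ratr q.1 : 'rV[R]_n) q.2.+1%:R^-1 x /\
    ball (map_mx ratr q.1 : 'rV[R]_n) q.2.+1%:R^-1 `<=` U.
Proof.
move=> /nbhs_ballP[e /= e0 eU].
have e20 : 0 < e / 2 by rewrite divr_gt0.
have [k ke] : exists k : nat, k.+1%:R^-1 < e / 2.
  have [k _ ke] := near_infty_natSinv_lt (PosNum e20).
  by exists k; exact: ke (leqnn k).
have k0 : 0 < k.+1%:R^-1 :> R by rewrite invr_gt0.
have /choice[v vx] : forall j, exists q : rat, ball (ratr q : R) k.+1%:R^-1 (x ord0 j).
  move=> j; have [|q] := @rat_in_itvoo R (x ord0 j - k.+1%:R^-1) (x ord0 j + k.+1%:R^-1).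
    by rewrite ltrBlDr -addrA ltrDl addr_gt0.
  by rewrite in_itv/= => /andP[xq qx]; exists q; rewrite /ball/= ltr_distl xq.
pose c : 'rV[R]_n := map_mx ratr (\row_j v j).
have cx : ball c k.+1%:R^-1 x by split => // i j; rewrite (ord1 i) !mxE.
exists (\row_j v j, k); split => // y cy; apply: eU.
apply: (@le_ball _ _ _ (k.+1%:R^-1 + k.+1%:R^-1)).
  by rewrite (splitr e) lerD// ltW.
by apply: ball_triangle cy; exact: ball_sym.
Qed.

(** Lindelof argument: a point outside the support has a rational ball around it that meets the set
    where [f] is nonzero in a negligible set, and there are only countably many rational balls. *)
Lemma negligible_setC_ess_supp (f : 'rV[R]_n -> R[i]) :
  mu.-negligible (~` ess_supp f `&` [set x | f x != 0]).
Proof.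
pose B (q : 'rV[rat]_n * nat) := ball (map_mx ratr q.1 : 'rV[R]_n) q.2.+1%:R^-1 `&`
  [set x | f x != 0].
pose F (k : nat) : set 'rV[R]_n := if unpickle k is Some q then
  (if `[< mu.-negligible (B q) >] then B q else set0) else set0.
apply: (@negligibleS _ _ _ _ (\bigcup_k F k)); last first.
  apply: negligible_bigcup => k; rewrite /F.
  case: unpickle => [q|]; last exact: negligible_set0.
  by case: ifPn => [/asboolP//|_]; exact: negligible_set0.
move=> x [/existsNP[U /not_implyP[Ux /contrapT Uf]] fx].
have [q [qx qU]] := rat_balls_basis Ux.
exists (pickle q) => //; rewrite /F pickleK; case: ifPn => [_|/asboolP[]].
  by split.
by apply: negligibleS Uf; exact: setSI.
Qed.

End ess_supp_theory.

Section ess_supp_bump.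
Context (R : realType) (n : nat) (s : R) (s0 : 0 < s) (b : 'rV[R]_n).
Local Notation mu := (lebesgue_rV R n).
Local Notation F := (fun w => (bump s b w)%:C%C : R[i]).

Lemma ess_supp_bump_sub :
  ess_supp F `<=` [set w | forall i, `|b ord0 i - w ord0 i| <= s].
Proof.
move=> w Fw i; rewrite leNgt; apply/negP => swi.
apply: (Fw [set v : 'rV[R]_n | s < `|b ord0 i - v ord0 i|]).
  apply: open_nbhs_nbhs; split => //.
  apply: (@open_comp _ _ (fun v : 'rV[R]_n => `|b ord0 i - v ord0 i|) [set t | s < t]);
    last exact: open_gt.
  move=> v _; have hc := @coord_continuous R 1 n ord0 i v.
  have h := cvg_norm (cvgB (@cvg_cst R^o (b ord0 i) _ (nbhs v) _) hc).
  exact: h.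
rewrite (_ : _ `&` _ = set0); first exact: negligible_set0.
apply/seteqP; split => // v /= [sv]; apply/negP; rewrite negbK.
by rewrite (bump_eq0 s0 (ltW sv)).
Qed.

(** The product of tents is positive on this ball, and every neighbourhood of one of its points
    contains a smaller ball of positive measure inside it. *)
Lemma ball_sub_ess_supp_bump : ball b s `<=` ess_supp F.
Proof.
move=> w bw U Uw Uneg.
have /nbhs_ballP[e /= e0 eU] : nbhs w (U `&` ball b s).
  by apply: filterI => //; apply: open_nbhs_nbhs; split => //; exact: ball_open.
have /negligibleP : mu.-negligible (ball w e).
  apply: negligibleS Uneg => v /eU[Uv [_ bv]]; split => //=.
  rewrite eq_complex/= eqxx andbT gt_eqF//; apply: prodr_gt0 => i _.
  rewrite tentE; last exact/ltW/bv.
  by rewrite mulr_gt0 ?fejer_mass_gt0// subr_gt0; exact: bv.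
have := lebesgue_rV_ball_gt0 w e0.
move=> /[swap] -> //; last by apply: open_measurable_rV; exact: ball_open.
by rewrite ltxx.
Qed.

Lemma compact_ess_supp_bump : compact (ess_supp F).
Proof.
apply: (subclosed_compact (@ess_supp_closed _ _ F)); last exact: ess_supp_bump_sub.
have := @rV_compact R n (fun i => `[b ord0 i - s, b ord0 i + s]%classic)
  (fun i => @segment_compact R _ _).
congr compact; apply/seteqP; split => w /= h i; have := h i;
  by rewrite /= in_itv/= ler_distlC.
Qed.

End ess_supp_bump.

(** * Lattices of diagonal matrices *)

Section diagonal_lattices.
Context (R : realType) (n : nat).

Lemma det_diag_mx (A : 'M[R]_n) : is_diag_mx A -> \det A = \prod_i A i i.
Proof.
move=> dA; have [d AE] : exists d, A = diag_mx d.
  by have /diag_mxP[d ->] := dA; exists d.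
by rewrite AE det_diag; apply: eq_bigr => i _; rewrite !mxE eqxx mulr1n.
Qed.

Section one_matrix.
Context (A : 'M[R]_n).
Hypotheses (A_unit : A \in unitmx) (A_diag : is_diag_mx A).

Lemma diag_unit_neq0 i : A i i != 0.
Proof.
have := A_unit; rewrite unitmxE unitfE det_diag_mx//.
by move=> /prodf_neq0/(_ i isT).
Qed.

Lemma covolumeE : covolume A = \prod_i `|A i i|.
Proof. by rewrite /covolume det_diag_mx// normr_prod. Qed.

Lemma covolume_gt0 : 0 < covolume A.
Proof.
by rewrite covolumeE; apply: prodr_gt0 => i _; rewrite normr_gt0 diag_unit_neq0.
Qed.

Definition annihilator_pt (k : 'rV[int]_n) : 'rV[R]_n :=
  \row_i ((k ord0 i)%:~R / A i i).

Lemma annihilatorE : annihilator A = range annihilator_pt.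
Proof.
rewrite /annihilator /lattice; congr (_ @` _); apply/funext => k.
have invE : invmx A = diag_mx (\row_i (A i i)^-1).
  set D := diag_mx _; suff AD : A *m D = 1%:M by rewrite -[LHS]mulmx1 -AD mulKmx.
  apply/matrixP => i j.
  rewrite !mxE (bigD1 i)//= !mxE big1 ?addr0; last first.
    by move=> l li; have /is_diag_mxP -> := A_diag; rewrite ?mul0r// eq_sym.
  case: eqVneq => _; last by rewrite mulr0n mulr0.
  by rewrite mulr1n mulfV// diag_unit_neq0.
rewrite -trmx_inv trmxK invE; apply/rowP => j; rewrite !mxE (bigD1 j)//= !mxE.
rewrite eqxx mulr1n big1 ?addr0// => l lj; rewrite !mxE (negbTE lj).
by rewrite mulr0n mulr0.
Qed.

Lemma annihilator_pt_inj : injective annihilator_pt.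
Proof.
move=> k l kl; apply/rowP => i; have /rowP/(_ i) := kl; rewrite !mxE.
by move=> /(mulIf _) h; apply: (@intr_inj R); apply: h; rewrite invr_eq0 diag_unit_neq0.
Qed.

(* In each coordinate, [a |-> A i i * a] maps the points of [X] to integers in
   an interval of length at most [2 * r * c]. *)
Lemma annihilator_count_le (c r : R) (w : 'rV[R]_n) (X : seq 'rV[R]_n) :
  0 <= r -> (forall i, `|A i i| <= c) -> uniq X ->
  (forall a, a \in X -> annihilator A a) ->
  (forall a, a \in X -> forall i, `|w ord0 i + a ord0 i| <= r) ->
  (size X)%:R <= (2 * r * c + 1) ^+ n.
Proof.
move=> r0 Ac uX XA Xr.
have c0 (i : 'I_n) : 0 <= c by exact: le_trans (normr_ge0 _) (Ac i).
(* The number of unit cells, starting at [lo i], that are needed to cover an interval of length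
   [2 * r * c]. *)
pose N := (Num.truncn (2 * r * c)).+1.
pose lo i : R := - (A i i * w ord0 i) - `|A i i| * r.
have bnd (a : seq_sub X) i : 0 <= A i i * val a ord0 i - lo i <= 2 * r * c.
  have := Xr _ (valP a) i; rewrite /lo => h.
  have h2 : `|A i i * (w ord0 i + val a ord0 i)| <= `|A i i| * r.
    by rewrite normrM ler_wpM2l.
  have h3 : `|A i i| * r <= c * r by rewrite ler_wpM2r.
  move: h2; rewrite ler_norml mulrDr => /andP[h4 h5].
  by rewrite /lo; apply/andP; split; clear - h3 h4 h5; lra.
have Ntr (a : seq_sub X) i : (Num.truncn (A i i * val a ord0 i - lo i) < N)%N.
  by rewrite ltnS; apply: le_truncn; have /andP[] := bnd a i.
(* Each point is sent to the cell of each of its rescaled coordinates; injectivity of this map gives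
   the count. *)
pose phi (a : seq_sub X) : {ffun 'I_n -> 'I_N} := [ffun i => Ordinal (Ntr a i)].
have phi_inj : injective phi.
  move=> a a' /ffunP aa'; apply/val_inj/rowP => i.
  have [k _ ka] : range annihilator_pt (val a) by rewrite -annihilatorE; exact: XA (valP _).
  have [k' _ ka'] : range annihilator_pt (val a') by rewrite -annihilatorE; exact: XA (valP _).
  rewrite -ka -ka' !mxE; congr (_%:~R / _).
  have := aa' i; rewrite !ffunE => /(congr1 val)/= tr.
  have /andP[l0 _] := bnd a i; have /andP[l0' _] := bnd a' i.
  have /andP[t1 t2] := truncn_itv l0; have /andP[t1' t2'] := truncn_itv l0'.
  have E : A i i * val a ord0 i = (k ord0 i)%:~R.
    by rewrite -ka mxE mulrC divfK// diag_unit_neq0.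
  have E' : A i i * val a' ord0 i = (k' ord0 i)%:~R.
    by rewrite -ka' mxE mulrC divfK// diag_unit_neq0.
  move: t1 t2 t1' t2'; rewrite tr E E' -(natr1 (Num.truncn _)).
  set t := (Num.truncn _)%:R; move=> t1 t2 t1' t2'.
  (* Both integers lie in the same half-open unit cell, so they differ by less than 1 and
     coincide. *)
  have : `|(k ord0 i)%:~R - (k' ord0 i)%:~R : R| < 1.
    by rewrite ltr_norml; apply/andP; split; clear - t1 t2 t1' t2'; lra.
  rewrite -intrB -intr_norm -[1]/(1%:~R) ltr_int; lia.
have := leq_card phi phi_inj.
rewrite card_ffun !card_ord card_seq_sub// => Xn.
apply: (@le_trans _ _ (N ^ n)%:R); first by rewrite ler_nat.
(* In dimension 0 no diagonal entry forces [c] to be nonnegative, but both powers are then 1. *)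
rewrite natrX; case: n c0 => [|n'] c0 //.
rewrite lerXn2r ?nnegrE//; first by rewrite addr_ge0// !mulr_ge0// (c0 ord0).
by rewrite /N -natr1 lerD2r truncn_le// !mulr_ge0// (c0 ord0).
Qed.

(** The integers from 0 to the integer part of [rho * c], taken in each coordinate, give lattice
    points with coordinates at most [rho]; there are at least [(rho * c) ^+ n] of them. *)
Lemma annihilator_count_ge (c rho : R) (D : 'rV[R]_n -> \bar R) (t0 : \bar R) :
  0 < rho -> 0 < c -> (forall i, c <= `|A i i|) -> (0 <= t0)%E ->
  (forall a, (0 <= D a)%E) ->
  (forall a : 'rV[R]_n, (forall i, `|a ord0 i| <= rho) -> (t0 <= D a)%E) ->
  (((rho * c) ^+ n)%:E * t0 <= \esum_(a in annihilator A) D a)%E.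
Proof.
move=> rho0 c0 cA t00 D0 Dt.
have rc0 : 0 <= rho * c by rewrite mulr_ge0// ltW.
pose N := (Num.truncn (rho * c)).+1.
pose e (phi : {ffun 'I_n -> 'I_N}) : 'rV[R]_n :=
  annihilator_pt (\row_i (phi i : nat)%:Z).
have e_inj : injective e.
  move=> p q /annihilator_pt_inj/rowP pq; apply/ffunP => i; apply/val_inj.
  by have := pq i; rewrite !mxE => -[].
apply: (@le_trans _ _ (#|{ffun 'I_n -> 'I_N}|%:R%:E * t0)%E).
  rewrite lee_wpmul2r// lee_fin card_ffun !card_ord natrX lerXn2r ?nnegrE//.
  exact/ltW/truncnS_gt.
apply: (esum_ge_card e_inj) => [p|p].
  by rewrite annihilatorE; exists (\row_i (p i : nat)%:Z).
apply: Dt => i; rewrite !mxE normrM normfV ler_pdivrMr ?normr_gt0 ?diag_unit_neq0//.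
rewrite normr_nat (le_trans (_ : _ <= rho * c))//; last by rewrite ler_wpM2l// ltW.
have : (p i <= Num.truncn (rho * c))%N by rewrite -ltnS.
by rewrite -(ler_nat R) => /le_trans; apply; rewrite truncn_le.
Qed.

End one_matrix.

(** The matrix [A^T *m A] is diagonal with entries [A i i ^+ 2]: any nonzero coordinate of an
    eigenvector identifies its eigenvalue, and the unit vectors realise all of them. *)
Lemma singular_values_diag (A : 'M[R]_n) : is_diag_mx A ->
  singular_values A = range (fun i => `|A i i|).
Proof.
move=> dA.
have sqE (v : 'rV[R]_n) j : (v *m (A^T *m A)) ord0 j = v ord0 j * A j j ^+ 2.
  have vA (B : 'M[R]_n) (u : 'rV[R]_n) l : is_diag_mx B -> (u *m B) ord0 l = u ord0 l * B l l.
    move=> /is_diag_mxP dB; rewrite mxE (bigD1 l)//= big1 ?addr0// => i il.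
    by rewrite dB ?mulr0.
  rewrite mulmxA !vA// ?mxE ?expr2 ?mulrA//.
  by apply/is_diag_mxP => a b ab; rewrite mxE; have /is_diag_mxP -> := dA; rewrite // eq_sym.
apply/seteqP; split => [s [s0 /eigenvalueP[v vs v0]]|_ [i _ <-]].
  have /rV0Pn[j vj] := v0; exists j => //.
  have := sqE v j; rewrite vs mxE mulrC => /(mulfI vj)/eqP.
  by rewrite eqf_sqr => /orP[]/eqP sE; rewrite -[RHS]ger0_norm// sE ?normrN.
split => //; apply/eigenvalueP; exists (delta_mx ord0 i).
  apply/rowP => j; rewrite sqE !mxE eqxx/=; case: eqVneq => [->|_].
    by rewrite mul1r mulr1 real_normK ?num_real.
  by rewrite mul0r mulr0.
by apply/rV0Pn; exists i; rewrite mxE !eqxx oner_eq0.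
Qed.

(** The chain is [|A i i| <= sup S <= K * inf S <= K * |A j j|], where [inf S] is positive because
    the smallest of finitely many nonzero moduli is attained. *)
Lemma diag_ratio_le (A : 'M[R]_n) (K : R) : A \in unitmx -> is_diag_mx A ->
  max_singular_value A / min_singular_value A <= K ->
  forall i j, `|A i i| <= K * `|A j j|.
Proof.
move=> uA dA; rewrite /max_singular_value /min_singular_value singular_values_diag//.
set S := (X in sup X / _) => SK i j.
have [i0 _ i0P] := arg_minP (fun i => `|A i i|) (isT : xpredT i).
have lbS : lbound S `|A i0 i0| by move=> _ [k _ <-]; exact: i0P.
have S0 : S !=set0 by exists `|A i i|; exists i.
have inf_gt0 : 0 < inf S.
  apply: lt_le_trans (lb_le_inf S0 lbS).
  by rewrite normr_gt0 diag_unit_neq0.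
have ubS : has_ubound S.
  have [i1 _ i1P] := arg_maxP (fun i => `|A i i|) (isT : xpredT i).
  by exists `|A i1 i1| => _ [k _ <-]; exact: i1P.
move: SK; rewrite ler_pdivrMr// => SK.
have supA : `|A i i| <= sup S by apply: ub_le_sup => //; exists i.
apply: (le_trans supA); apply: (le_trans SK); apply: ler_wpM2l.
  (* [K] is nonnegative because [K * inf S] bounds a modulus from above and [inf S] is positive. *)
  by rewrite -(pmulr_lge0 _ inf_gt0) (le_trans _ SK)// (le_trans _ supA).
by apply: ge_inf; [exists `|A i0 i0| | exists j].
Qed.

End diagonal_lattices.

(** * The local integrability condition through Tonelli *)

Lemma normc_ge0 (R : realType) (z : R[i]) : 0 <= normc z.
Proof. by case: z => a b; exact: sqrtr_ge0. Qed.

Lemma normc_sqr (R : realType) (z : R[i]) :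
  normc z ^+ 2 = complex.Re z ^+ 2 + complex.Im z ^+ 2.
Proof. by case: z => a b; rewrite /normc/= sqr_sqrtr// addr_ge0// sqr_ge0. Qed.

Lemma measurable_normc_sqr (R : realType) dT (T : measurableType dT) (f : T -> R[i]) :
  cmeasurable f -> measurable_fun [set: T] (fun x => normc (f x) ^+ 2).
Proof.
move=> [mr mi]; under eq_fun do rewrite normc_sqr.
by apply: measurable_funD; apply: measurable_funX.
Qed.

Section energy.
Context (R : realType) (n : nat).
Local Notation leb := (lebesgue_rV R n).
Context (dP : measure_display) (P : measurableType dP)
  (m : {sigma_finite_measure set P -> \bar R}).
Context (gh : P -> 'rV[R]_n -> R[i]).
Hypothesis gh_meas : jointly_measurable gh.
Local Open Scope ereal_scope.

Definition energy (w : 'rV[R]_n) : \bar R := \int[m]_p (normc (gh p w) ^+ 2)%:E.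

Let sq (q : P * 'rV[R]_n) : \bar R := (normc (gh q.1 q.2) ^+ 2)%:E.

Let msq : measurable_fun [set: P * 'rV[R]_n] sq.
Proof. by apply/measurable_EFinP; exact: measurable_normc_sqr. Qed.

Let sq0 q : 0 <= sq q.
Proof. by rewrite lee_fin sqr_ge0. Qed.

Lemma energy_ge0 w : 0 <= energy w.
Proof. by apply: integral_ge0 => p _; rewrite lee_fin sqr_ge0. Qed.

Lemma measurable_energy : measurable_fun [set: 'rV[R]_n] energy.
Proof. exact: (measurable_fun_fubini_tonelli_G (m1 := m) sq). Qed.

(** The indicator turns an integral over [S] into one over the whole space, the form in which
    Tonelli applies. *)
Let sqS (S : set 'rV[R]_n) q := sq q * (\1_S q.2)%:E.

Let msqS S : measurable S -> measurable_fun [set: P * 'rV[R]_n] (sqS S).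
Proof.
move=> mS; apply: emeasurable_funM => //.
apply/measurable_EFinP.
exact: (measurableT_comp (measurable_indic mS) (@measurable_snd _ _ P 'rV[R]_n)).
Qed.

Let sqS_ge0 S q : 0 <= sqS S q.
Proof. by rewrite mule_ge0// lee_fin. Qed.

Let sqSE S p w : sqS S (p, w) = ((fun w => (normc (gh p w) ^+ 2)%:E) \_ S) w.
Proof. by rewrite epatch_indic. Qed.

Lemma energy_tonelli (S : set 'rV[R]_n) : measurable S ->
  \int[m]_p \int[leb]_(w in S) (normc (gh p w) ^+ 2)%:E =
  \int[leb]_(w in S) energy w.
Proof.
move=> mS; have := fubini_tonelli (m1 := m) (m2 := leb) (sqS S) (msqS mS) (sqS_ge0 S).
under eq_integral => p _.
  under eq_integral do rewrite sqSE.
  rewrite -integral_mkcond; over.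
move=> ->; rewrite [RHS]integral_mkcond.
apply: eq_integral => w _; rewrite epatch_indic/=.
rewrite -ge0_integralZr//; last by move=> p _; rewrite lee_fin sqr_ge0.
exact: (measurableT_comp msq (measurable_pair2 w)).
Qed.

Lemma measurable_section_integral (S : set 'rV[R]_n) : measurable S ->
  measurable_fun [set: P] (fun p => \int[leb]_(w in S) (normc (gh p w) ^+ 2)%:E).
Proof.
move=> mS.
have := measurable_fun_fubini_tonelli_F (m2 := leb) (sqS S) (msqS mS) (sqS_ge0 S).
apply: eq_measurable_fun => p _; rewrite [RHS]integral_mkcond.
by apply: eq_integral => w _; rewrite sqSE.
Qed.

End energy.

(** * Two-sided bounds for sums over the annihilator *)

Section lattice_sums.
Context (R : realType) (n : nat).
Local Notation leb := (lebesgue_rV R n).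

Lemma cmeasurable_shift (F : 'rV[R]_n -> R[i]) (a : 'rV[R]_n) :
  cmeasurable F -> cmeasurable (fun w : 'rV[R]_n => F (w + a)).
Proof.
move=> [mr mi]; split.
  exact: (measurableT_comp mr (measurable_xshift a)).
exact: (measurableT_comp mi (measurable_xshift a)).
Qed.

Lemma measurable_lattice_term (F v : 'rV[R]_n -> R[i]) (a : 'rV[R]_n) :
  cmeasurable F -> cmeasurable v ->
  measurable_fun [set: 'rV[R]_n] (fun w : 'rV[R]_n => (normc (F (w + a) * v w) ^+ 2)%:E).
Proof.
move=> mF mv; apply/measurable_EFinP.
under eq_fun do rewrite normcM exprMn.
apply: measurable_funM; apply: measurable_normc_sqr => //.
exact: cmeasurable_shift.
Qed.

Lemma ae_shift_seq (B : set 'rV[R]_n) (t : seq 'rV[R]_n) : leb.-negligible B ->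
  {ae leb, forall w : 'rV[R]_n, forall a, a \in t -> ~ B (w + a)}.
Proof.
move=> nB; elim: t => [|a t IH]; first by apply: nearW.
have : {ae leb, forall w : 'rV[R]_n, ~ B (w + a)}.
  apply: negligibleS (negligible_shift a nB) => w /=.
  by move=> /contrapT.
move=> Ha; near=> w => x; rewrite inE => /orP[/eqP ->|]; first by near: w.
by move: x; near: w.
Unshelve. all: end_near. Qed.

(** For almost every [w], a term is nonzero only if [w + a] lies in the support of [F]. This
    confines [a] to a box with at most [(2 * r * c + 1) ^+ n] lattice points, and each of them
    contributes a factor of at most [M ^+ 2]. *)
Lemma lattice_sum_le (A : 'M[R]_n) (c r M : R) (F v : 'rV[R]_n -> R[i]) :
  A \in unitmx -> is_diag_mx A -> (forall i, `|A i i| <= c) ->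
  cmeasurable F -> cmeasurable v -> 0 <= r -> 0 <= c ->
  (forall w, ess_supp F w -> forall i, `|w ord0 i| <= r) ->
  {ae leb, forall w : 'rV[R]_n, normc (F w) <= M} ->
  (\esum_(a in annihilator A) \int[leb]_(w in ess_supp F)
     (normc (F (w + a)%R * v w)%R ^+ 2)%:E <=
   (M ^+ 2 * (2 * r * c + 1) ^+ n)%:E * \int[leb]_(w in ess_supp F)
     (normc (v w) ^+ 2)%:E)%E.
Proof.
move=> uA dA Ac mF mv r0 c0 Fr FM.
have mS : measurable (ess_supp F) by exact: (closed_measurable_rV (@ess_supp_closed _ _ F)).
have mv2 : measurable_fun (ess_supp F) (fun w : 'rV[R]_n => (normc (v w) ^+ 2)%:E).
  by apply/measurable_funTS/measurable_EFinP; exact: measurable_normc_sqr.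
have K0 : 0 <= M ^+ 2 * (2 * r * c + 1) ^+ n.
  by rewrite mulr_ge0 ?sqr_ge0// exprn_ge0// addr_ge0// !mulr_ge0.
(* The sum is a supremum of finite partial sums, so each of these is bounded separately. *)
apply: ge_ereal_sup => _ [X [finX XA] <-].
have [t ut XE] : exists2 t, uniq t & X = [set` t].
  have /finite_seqP[t ->] := finX; exists (undup t); first exact: undup_uniq.
  by apply/seteqP; split => a /=; rewrite mem_undup.
have tA a : a \in t -> annihilator A a by move=> aX; apply: XA; rewrite XE.
rewrite XE -fsbig_seq//.
rewrite -ge0_integral_sum//; last 2 first.
- by move=> a; apply: measurable_funTS; exact: measurable_lattice_term.
- by move=> a w _; rewrite lee_fin sqr_ge0.
rewrite -ge0_integralZl//; last by move=> w _; rewrite lee_fin sqr_ge0.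
apply: ae_ge0_le_integral => //.
- by move=> w _; apply: sume_ge0 => a _; rewrite lee_fin sqr_ge0.
- apply: emeasurable_sum => a; apply: measurable_funTS.
  exact: measurable_lattice_term.
- by move=> w _; rewrite mule_ge0 ?lee_fin// sqr_ge0.
- exact: measurable_funeM.
(* The exceptional points: those where [F] is nonzero off its essential support, or exceeds [M].
   Only finitely many translates of this null set must be avoided. *)
pose B := (~` ess_supp F `&` [set w | F w != 0]) `|` ~` [set w | normc (F w) <= M].
have nB : leb.-negligible B.
  by apply: negligibleU => //; exact: negligible_setC_ess_supp.
have := ae_shift_seq t nB; apply: filterS => w wB _.
rewrite sumEFin -EFinM lee_fin.
under eq_bigr do rewrite normcM exprMn.
rewrite -mulr_suml ler_wpM2r ?sqr_ge0//.
(* [Q] keeps the translates that stay in the box containing the support; [F] vanishes at all the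
   others. *)
pose Q a := [forall i, `|w ord0 i + (a : 'rV[R]_n) ord0 i| <= r].
rewrite (bigID Q)/= [X in _ + X]big1_seq ?addr0; last first.
  move=> a /andP[Qa ta].
  have [->|Fa] := eqVneq (F (w + a)) 0; first by rewrite normc0 expr0n.
  exfalso; apply: (wB a ta); left; split => // Sa.
  move/negP : Qa; apply; apply/forallP => i.
  by have := Fr _ Sa i; rewrite mxE.
rewrite -big_filter.
apply: (@le_trans _ _ (\sum_(a <- [seq a <- t | Q a]) M ^+ 2)).
  rewrite big_seq [leRHS]big_seq; apply: ler_sum => a.
  rewrite mem_filter => /andP[_ ta].
  have FaM : normc (F (w + a)) <= M.
    by rewrite leNgt; apply/negP => h; apply: (wB a ta); right => /=; apply/negP; rewrite -ltNge.
  by rewrite lerXn2r// ?nnegrE ?normc_ge0// (le_trans _ FaM)// normc_ge0.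
rewrite big_const_seq count_predT iter_addr_0 -(mulr_natr _ (size _)) ler_wpM2l ?sqr_ge0//.
apply: (annihilator_count_le (w := w) uA dA r0 Ac) => [||a].
- exact: filter_uniq.
- by move=> a; rewrite mem_filter => /andP[_ /tA].
- by rewrite mem_filter => /andP[/forallP].
Qed.

(** If [w] is within [s / 4] of [b] and the coordinates of [a] are at most [s / 4], then [w + a] is
    within [s / 2] of [b], where each tent is at least half its height. Hence the squared bump is at
    least [k]. *)
Lemma lattice_sum_bump_ge (A : 'M[R]_n) (c s : R) (b : 'rV[R]_n)
    (v : 'rV[R]_n -> R[i]) (k := ((s / 2) * fejer_mass R) ^+ n ^+ 2) :
  A \in unitmx -> is_diag_mx A -> 0 < c -> (forall i, c <= `|A i i|) ->
  cmeasurable v -> 0 < s ->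
  let F := fun w : 'rV[R]_n => (bump s b w)%:C%C in
  let L := (\esum_(a in annihilator A) \int[leb]_(w in ess_supp F)
     (normc (F (w + a)%R * v w)%R ^+ 2)%:E)%E in
  let I := (\int[leb]_(w in ball b (s / 4)) (normc (v w) ^+ 2)%:E)%E in
  (k%:E * I <= L)%E /\ (((s / 4 * c) ^+ n)%:E * (k%:E * I) <= L)%E.
Proof.
move=> uA dA c0 cA mv s0 F L I.
have s4 : 0 < s / 4 by rewrite divr_gt0.
have k0 : 0 <= k by rewrite sqr_ge0.
have mF : cmeasurable F by split => //=; exact: measurable_bump.
have mS : measurable (ess_supp F) by exact: (closed_measurable_rV (@ess_supp_closed _ _ F)).
have mQ : measurable (ball b (s / 4)) by apply: open_measurable_rV; exact: ball_open.
have QS : ball b (s / 4) `<=` ess_supp F.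
  apply: (@subset_trans _ (ball b s)); last exact: ball_sub_ess_supp_bump.
  by apply: le_ball; rewrite ler_pdivrMr// ler_peMr ?(ltW s0)// ler1n.
have I0 : (0 <= I)%E by apply: integral_ge0 => w _; rewrite lee_fin sqr_ge0.
have key (a : 'rV[R]_n) : (forall i, `|a ord0 i| <= s / 4) ->
    (k%:E * I <= \int[leb]_(w in ess_supp F) (normc (F (w + a)%R * v w)%R ^+ 2)%:E)%E.
  move=> ha; apply: (@le_trans _ _ (\int[leb]_(w in ball b (s / 4))
      (normc (F (w + a)%R * v w)%R ^+ 2)%:E)%E); last first.
    apply: ge0_subset_integral => //; last by move=> w _; rewrite lee_fin sqr_ge0.
    by apply: measurable_funTS; exact: measurable_lattice_term.
  rewrite -ge0_integralZl//; last 2 first.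
  - by apply/measurable_funTS/measurable_EFinP; exact: measurable_normc_sqr.
  - by move=> w _; rewrite lee_fin sqr_ge0.
  apply: le_ge0_integral => w; first by rewrite mule_ge0// lee_fin sqr_ge0.
  move=> [_ bw]; rewrite -EFinM lee_fin normcM exprMn ler_wpM2r ?sqr_ge0//.
  rewrite normc_bump// lerXn2r ?nnegrE ?bump_ge0//.
    by rewrite exprn_ge0// mulr_ge0 ?divr_ge0 ?(ltW s0)// ltW// fejer_mass_gt0.
  rewrite [X in (X * _) ^+ _](_ : _ = s - s / 2); last by field.
  apply: bump_ge => //; first by apply/andP; split; lra.
  move=> i; rewrite mxE opprD addrA (le_trans (ler_normB _ _))//.
  by rewrite (_ : s / 2 = s / 4 + s / 4); [rewrite lerD// ltW//; exact: bw|field].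
(* The first bound keeps only [a = 0]; the second one sums [key] over the many
   points of the lattice with coordinates at most [s / 4]. *)
split; last first.
  apply: annihilator_count_ge => //; first by rewrite mule_ge0.
  by move=> a; apply: integral_ge0 => w _; rewrite lee_fin sqr_ge0.
rewrite -[leLHS]mul1e -[1%E]/((1%:R)%:E) -card_unit.
apply: (@esum_ge_card R unit _ _ (fun=> 0)) => [|_|_].
- by move=> [] [].
- by rewrite annihilatorE//; exists 0 => //; apply/rowP => i; rewrite !mxE mul0r.
- by apply: key => i; rewrite mxE normr0 ltW.
Qed.

End lattice_sums.

(** * From local bounds to compact sets *)

Section local_to_compact.
Context (R : realType) (n : nat).
Local Notation leb := (lebesgue_rV R n).

Lemma normr_coord_le (v : 'rV[R]_n) i : `|v ord0 i| <= `|v|.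
Proof.
rewrite [leRHS]/Num.norm /= mx_normrE; apply/bigmax_geP; right => /=.
by exists (ord0, i).
Qed.

Lemma compact_coord_bounded (K : set 'rV[R]_n) : compact K ->
  exists2 r : R, 0 <= r & forall w, K w -> forall i, `|w ord0 i| <= r.
Proof.
(* This radius is nonnegative and strictly larger than [M], as [KM] requires. *)
move=> /compact_bounded[M [_ KM]]; exists (Num.max 0 M + 1).
  by rewrite addr_ge0// le_max lexx.
move=> w Kw i; apply: (le_trans (normr_coord_le w i)); apply: KM Kw.
by rewrite (@le_lt_trans _ _ (Num.max 0 M)) ?le_max ?lexx ?orbT// ltrDl.
Qed.

(** Finitely many of the given balls cover [K], and the integral over their union is finite by
    induction on the cover. *)
Lemma loc_integrable_off_local (E : set 'rV[R]_n) (f : 'rV[R]_n -> \bar R) :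
  measurable_fun [set: 'rV[R]_n] f -> (forall w, 0 <= f w)%E ->
  (forall x, ~ E x -> exists2 e : R, 0 < e & (\int[leb]_(w in ball x e) f w < +oo)%E) ->
  loc_integrable_off E f.
Proof.
move=> mf f0 loc K cK KE.
have mK := compact_measurable_rV cK.
apply/integrableP; split; first exact: measurable_funTS.
under eq_integral do rewrite gee0_abs//.
(* The radius 0 is a dummy value at points of [E]. *)
have /choice[e eP] : forall x : 'rV[R]_n, exists e : R, ~ E x ->
    0 < e /\ (\int[leb]_(w in ball x e) f w < +oo)%E.
  move=> x; have [Ex|nEx] := pselect (E x); first by exists 0.
  by have [e e0 h] := loc x nEx; exists e.
have mb x : ~ E x -> measurable (ball x (e x)).
  by move=> /eP[e0 _]; apply: open_measurable_rV; exact: ball_open.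
move: cK; rewrite compact_cover.
move=> /(_ _ [set x | ~ E x] (fun x => ball x (e x))) [||D DE KD].
- by move=> x /eP[e0 _]; exact: ball_open.
- by move=> x Kx; exists x; [exact: KE|apply: ballxx; exact: (eP x (KE _ Kx)).1].
have [t tE Kt] : exists2 t : seq 'rV[R]_n, (forall x, x \in t -> ~ E x) &
    K `<=` \big[setU/set0]_(x <- t) ball x (e x).
  have /finite_seqP[t tD] := finite_fset D; exists t.
    by move=> x xt; have : [set` t] x := xt; rewrite -tD => /DE; rewrite inE.
  by rewrite -bigcup_seq -tD.
have mU : forall u : seq 'rV[R]_n, (forall x, x \in u -> ~ E x) ->
    measurable (\big[setU/set0]_(x <- u) ball x (e x)).
  move=> u uE; rewrite big_seq; apply: bigsetU_measurable => x xu.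
  exact: (mb _ (uE _ xu)).
apply: (@le_lt_trans _ _ (\int[leb]_(w in \big[setU/set0]_(x <- t) ball x (e x)) f w)%E).
  by apply: ge0_subset_integral => //; [exact: mU|exact: measurable_funTS].
elim: t tE {Kt} => [|x t IH] xtE; first by rewrite big_nil integral_set0.
have tE y : y \in t -> ~ E y by move=> yt; apply: xtE; rewrite inE yt orbT.
have xE : ~ E x by apply: xtE; rewrite inE eqxx.
(* The union is made disjoint by removing the remaining balls from the first one, so that the
   integral becomes additive. *)
rewrite big_cons (_ : _ `|` _ = ball x (e x) `\` \big[setU/set0]_(y <- t) ball y (e y)
  `|` \big[setU/set0]_(y <- t) ball y (e y)); last by rewrite setUDl setDv setD0.
rewrite ge0_integral_setU//; last 4 first.
- by apply: measurableD; [exact: mb|exact: mU].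
- exact: mU.
- exact: measurable_funTS.
- by rewrite disj_set2E setDKI.
apply: lte_add_pinfty; last exact: IH.
apply: le_lt_trans (eP x xE).2; apply: ge0_subset_integral => //.
- by apply: measurableD; [exact: mb|exact: mU].
- exact: mb.
- exact: measurable_funTS.
Qed.

End local_to_compact.

Section energy_lattice.
Context (R : realType) (n : nat).
Local Notation leb := (lebesgue_rV R n).

(* The default value of [xget] is jointly measurable as well, so the existence of
   a measurable version of the transform is not needed. *)
Lemma jointly_measurable_fourier_family dP (P : measurableType dP)
  (g : P -> 'rV[R]_n -> R[i]) : jointly_measurable (fourier_family g).
Proof.
rewrite /fourier_family; case: xgetP => [h _ []//|_].
by split => /=; exact: measurable_cst.
Qed.

Context (dP : measure_display) (P : measurableType dP)
  (m : {sigma_finite_measure set P -> \bar R}).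
Context (gh : P -> 'rV[R]_n -> R[i]).
Hypothesis gh_meas : jointly_measurable gh.

Lemma cmeasurable_section p : cmeasurable (gh p).
Proof.
by case: gh_meas => mr mi; split;
  [exact: (measurableT_comp mr (measurable_pair1 p))|
   exact: (measurableT_comp mi (measurable_pair1 p))].
Qed.

Context (A : 'M[R]_n) (uA : A \in unitmx) (dA : is_diag_mx A).

Lemma energy_lattice_le (c r M : R) (F : 'rV[R]_n -> R[i]) :
  (forall i, `|A i i| <= c) -> cmeasurable F -> 0 <= r -> 0 <= c ->
  (forall w, ess_supp F w -> forall i, `|w ord0 i| <= r) ->
  {ae leb, forall w : 'rV[R]_n, normc (F w) <= M} ->
  (\int[m]_p (\esum_(a in annihilator A) \int[leb]_(w in ess_supp F)
     (normc (F (w + a)%R * gh p w)%R ^+ 2)%:E) <=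
   (M ^+ 2 * (2 * r * c + 1) ^+ n)%:E * \int[leb]_(w in ess_supp F) energy m gh w)%E.
Proof.
move=> Ac mF r0 c0 Fr FM.
have mS := closed_measurable_rV (@ess_supp_closed _ _ F).
rewrite -energy_tonelli// -ge0_integralZl//; last 3 first.
- exact: measurable_section_integral.
- by move=> p _; apply: integral_ge0 => w _; rewrite lee_fin sqr_ge0.
- by rewrite lee_fin mulr_ge0 ?sqr_ge0// exprn_ge0// addr_ge0// !mulr_ge0.
apply: le_ge0_integral => p _.
  apply: esum_ge0 => a _; apply: integral_ge0 => w _.
  by rewrite lee_fin sqr_ge0.
by apply: lattice_sum_le => //; exact: cmeasurable_section.
Qed.

(** After division by the covolume, the first bound yields the Calderon condition and the second one
    strict temperateness. *)
Lemma energy_lattice_bump_ge (c s : R) (b : 'rV[R]_n)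
    (k := ((s / 2) * fejer_mass R) ^+ n ^+ 2) :
  0 < c -> (forall i, c <= `|A i i|) -> 0 < s ->
  let F := fun w : 'rV[R]_n => (bump s b w)%:C%C in
  let L := (\int[m]_p \esum_(a in annihilator A) \int[leb]_(w in ess_supp F)
     (normc (F (w + a)%R * gh p w)%R ^+ 2)%:E)%E in
  let I := (\int[leb]_(w in ball b (s / 4)) energy m gh w)%E in
  (k%:E * I <= L)%E /\ (((s / 4 * c) ^+ n * k)%:E * I <= L)%E.
Proof.
move=> c0 cA s0 F L I.
have s4 : 0 < s / 4 by rewrite divr_gt0.
have mQ : measurable (ball b (s / 4)) by apply: open_measurable_rV; exact: ball_open.
have k0 : 0 <= k by rewrite sqr_ge0.
rewrite /I -energy_tonelli//.
have i0 p : (0 <= \int[leb]_(w in ball b (s / 4)) (normc (gh p w) ^+ 2)%:E)%E.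
  by apply: integral_ge0 => w _; rewrite lee_fin sqr_ge0.
have q0 : 0 <= (s / 4 * c) ^+ n by rewrite exprn_ge0// mulr_ge0// ltW.
have mI := measurable_section_integral gh_meas mQ.
have [h1 h2] : (forall p, (k%:E * \int[leb]_(w in ball b (s / 4)) (normc (gh p w) ^+ 2)%:E <=
    \esum_(a in annihilator A) \int[leb]_(w in ess_supp F)
     (normc (F (w + a)%R * gh p w)%R ^+ 2)%:E)%E) /\
  (forall p, (((s / 4 * c) ^+ n)%:E *
      (k%:E * \int[leb]_(w in ball b (s / 4)) (normc (gh p w) ^+ 2)%:E) <=
    \esum_(a in annihilator A) \int[leb]_(w in ess_supp F)
     (normc (F (w + a)%R * gh p w)%R ^+ 2)%:E)%E).
  split => p; have [] := lattice_sum_bump_ge b uA dA c0 cA (cmeasurable_section p) s0; by [].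
split.
  rewrite -ge0_integralZl//; apply: le_ge0_integral => p _; last exact: h1.
  by rewrite mule_ge0.
have qk0 : 0 <= (s / 4 * c) ^+ n * k by exact: mulr_ge0.
rewrite -ge0_integralZl ?lee_fin//; apply: le_ge0_integral => p _.
  by rewrite mule_ge0.
by rewrite EFinM -muleA; exact: h2.
Qed.

End energy_lattice.

(** * The equivalence *)

(** [a + 1] is at most twice the larger of [a] and 1. *)
Lemma exprD1_le (R : realType) n (a : R) : 0 <= a ->
  (a + 1) ^+ n <= 2 ^+ n * (a ^+ n + 1).
Proof.
move=> a0; have a1 : 0 <= a + 1 by rewrite addr_ge0.
have [le1|/ltW ge1] := leP a 1.
  apply: (@le_trans _ _ (2 ^+ n)); last by rewrite ler_peMr ?exprn_ge0// lerDr exprn_ge0.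
  by rewrite lerXn2r ?nnegrE//; clear - le1; lra.
apply: (@le_trans _ _ ((2 * a) ^+ n)).
  by rewrite lerXn2r ?nnegrE ?mulr_ge0//; clear - ge1; lra.
by rewrite exprMn ler_wpM2l ?exprn_ge0// lerDl.
Qed.

(** * Lattice counts compared with the covolume *)

Section covolume_bounds.
Context (R : realType) (n : nat) (A : 'M[R]_n) (kappa : R) (i0 : 'I_n).
Hypotheses (uA : A \in unitmx) (dA : is_diag_mx A) (k1 : 1 <= kappa).
Hypothesis ratio : forall i j, `|A i i| <= kappa * `|A j j|.
(** A reference modulus: all diagonal moduli lie between [c / kappa] and [kappa * c], so the
    covolume is comparable to [c ^+ n]. *)
Let c := `|A i0 i0|.
Let c0 : 0 < c. Proof. by rewrite normr_gt0 diag_unit_neq0. Qed.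
Let k0 : 0 < kappa. Proof. exact: lt_le_trans k1. Qed.

Lemma covolume_le : covolume A <= (kappa * c) ^+ n.
Proof.
rewrite covolumeE// -[X in _ ^+ X]card_ord -prodr_const.
by apply: ler_prod => i _; rewrite normr_ge0 ratio.
Qed.

Lemma covolume_ge : (c / kappa) ^+ n <= covolume A.
Proof.
rewrite covolumeE// -[X in _ ^+ X]card_ord -prodr_const.
apply: ler_prod => i _; apply/andP; split; first by rewrite divr_ge0 ?(ltW c0) ?(ltW k0).
by rewrite ler_pdivrMr// mulrC; exact: ratio.
Qed.

(** The power of the sum splits into a multiple of [c ^+ n], which the covolume absorbs, and a
    constant. The two resulting terms are controlled by strict temperateness and by the Calderon
    condition respectively. *)
Lemma count_div_covolume_le (r : R) : 0 <= r ->
  (covolume A)^-1 * (2 * r * (kappa * c) + 1) ^+ n <=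
  2 ^+ n * (2 * r * kappa ^+ 2) ^+ n + 2 ^+ n * (covolume A)^-1.
Proof.
move=> r0; have V0 := covolume_gt0 uA dA.
have rc0 : 0 <= 2 * r * (kappa * c) by rewrite !mulr_ge0// ltW.
rewrite mulrC ler_pdivrMr// [leRHS]mulrDl mulfVK ?gt_eqF//.
apply: (le_trans (exprD1_le n rc0)); rewrite mulrDr mulr1 lerD2r -[leRHS]mulrA.
rewrite ler_wpM2l ?exprn_ge0//.
rewrite (_ : 2 * r * (kappa * c) = 2 * r * kappa ^+ 2 * (c / kappa)); last first.
  by field; rewrite gt_eqF.
by rewrite exprMn ler_wpM2l ?covolume_ge// exprn_ge0// !mulr_ge0// ltW.
Qed.

(** The covolume is at most [(kappa * c) ^+ n], so the growth of the count cancels the weight and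
    leaves a constant that depends on [A] only through [kappa]. *)
Lemma count_div_covolume_ge (rho : R) : 0 <= rho ->
  (rho / kappa ^+ 2) ^+ n <= (covolume A)^-1 * (rho * (c / kappa)) ^+ n.
Proof.
move=> r0; have V0 := covolume_gt0 uA dA.
rewrite [leRHS]mulrC ler_pdivlMr//.
apply: (@le_trans _ _ ((rho / kappa ^+ 2) ^+ n * (kappa * c) ^+ n)).
  by rewrite ler_wpM2l ?covolume_le// exprn_ge0// divr_ge0// exprn_ge0// ltW.
rewrite -exprMn (_ : rho / kappa ^+ 2 * (kappa * c) = rho * (c / kappa))//.
by field; rewrite gt_eqF.
Qed.

End covolume_bounds.

Lemma ae_bounded_cLnormy (R : realType) n (F : 'rV[R]_n -> R[i]) :
  (cLnorm +oo F < +oo)%E ->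
  exists M : R, {ae lebesgue_rV R n, forall w, normc (F w) <= M}.
Proof.
rewrite /cLnorm unlock; case: ifPn => [_|/negbTE h _].
  move=> Foo; have h := ess_sup_ge (lebesgue_rV R n) (abse \o (fun x => (normc (F x))%:E)).
  move: Foo h; case: ess_sup => [M|//|] _ h.
    exists M; apply: filterS h => w /=; rewrite lee_fin; apply: le_trans.
    exact: ler_norm.
  (* If the essential supremum is [-oo], the almost sure inequality is contradictory, and any bound
     will do. *)
  by exists 0; apply: filterS h => w.
(* In the remaining branch of the norm the whole space has measure zero. *)
exists 0; exists setT; split => //; apply/eqP.
by rewrite eq_le measure_ge0 leNgt h.
Qed.

Section integrability_conditions.
Context (R : realType) (n : nat) (i0 : 'I_n) (kappa : R) (J : countType)
  (C : J -> 'M[R]_n).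
Hypotheses (uC : forall j, C j \in unitmx) (dC : forall j, is_diag_mx (C j)).
Hypotheses (k1 : 1 <= kappa).
Hypothesis ratio : forall j a b, `|C j a a| <= kappa * `|C j b b|.
Context (dP : J -> measure_display) (P : forall j, measurableType (dP j))
  (mu : forall j, {sigma_finite_measure set (P j) -> \bar R})
  (g : forall j, P j -> 'rV[R]_n -> R[i]) (E : set 'rV[R]_n).
Local Notation leb := (lebesgue_rV R n).
Local Open Scope ereal_scope.

Let gh j := fourier_family (@g j).
Let G j := energy (mu j) (@gh j).
Let V j := covolume (C j).

Let gh_meas j : jointly_measurable (@gh j).
Proof. exact: jointly_measurable_fourier_family. Qed.

Let V_gt0 j : (0 < V j)%R.
Proof. exact: covolume_gt0. Qed.

Let iV_ge0 j : (0 <= (V j)^-1)%R.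
Proof. by rewrite invr_ge0 ltW. Qed.

Let k0 : (0 < kappa)%R. Proof. exact: lt_le_trans k1. Qed.

Let G0 j w : 0 <= G j w.
Proof. exact: energy_ge0. Qed.

Let mG j : measurable_fun [set: 'rV[R]_n] (G j).
Proof. exact: measurable_energy. Qed.

Let VG0 j w : 0 <= (V j)^-1%:E * G j w.
Proof. by rewrite mule_ge0 ?lee_fin. Qed.

Let mVG j : measurable_fun [set: 'rV[R]_n] (fun w => (V j)^-1%:E * G j w).
Proof. exact: measurable_funeM. Qed.

Let integral_G_ge0 j (S : set 'rV[R]_n) : 0 <= \int[leb]_(w in S) G j w.
Proof. exact: integral_ge0. Qed.

Let integral_VG (S : set 'rV[R]_n) : measurable S ->
  \int[leb]_(w in S) (\esum_(j in [set: J]) ((V j)^-1%:E * G j w)) =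
  \esum_(j in [set: J]) ((V j)^-1%:E * \int[leb]_(w in S) G j w).
Proof.
move=> mS; rewrite integral_esum//; apply: eq_esum => j _.
by rewrite ge0_integralZl ?lee_fin//; exact: measurable_funTS.
Qed.

Lemma calderon_temperate_lic :
  calderon_integrability_condition C mu g E -> strictly_temperate mu g E ->
  local_integrability_condition C mu g E.
Proof.
move=> cal temp f F [_ [mF _] _] Fbd cS SE.
have mS := compact_measurable_rV cS.
have [r r0 Sr] := compact_coord_bounded cS.
have [M FM] := ae_bounded_cLnormy Fbd.
pose I j := \int[leb]_(w in ess_supp F) G j w.
have tempS : \esum_(j in [set: J]) I j < +oo.
  have /integrableP[_] := temp _ cS SE.
  rewrite -integral_esum//; apply: le_lt_trans.
  by apply: le_ge0_integral => w _; [exact: esum_ge0|rewrite lee_abs].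
have calS : \esum_(j in [set: J]) ((V j)^-1%:E * I j) < +oo.
  have /integrableP[_] := cal _ cS SE.
  rewrite -integral_VG//; apply: le_lt_trans.
  by apply: le_ge0_integral => w _; [exact: esum_ge0|rewrite lee_abs].
(* [M ^+ 2] bounds the square of the transform; the other factors are the two coefficients in
   [count_div_covolume_le]. *)
pose K1 : R := (M ^+ 2 * (2 ^+ n * (2 * r * kappa ^+ 2) ^+ n))%R.
pose K2 : R := (M ^+ 2 * 2 ^+ n)%R.
have K1_ge0 : (0 <= K1)%R.
  apply: mulr_ge0; first exact: sqr_ge0.
  by apply: mulr_ge0; apply: exprn_ge0; rewrite ?mulr_ge0 ?exprn_ge0// ltW.
have K2_ge0 : (0 <= K2)%R by apply: mulr_ge0; [exact: sqr_ge0|exact: exprn_ge0].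
apply: (@le_lt_trans _ _ (\esum_(j in [set: J])
    (K1%:E * I j + K2%:E * ((V j)^-1%:E * I j)))); last first.
  have I0 j : 0 <= I j by exact: integral_G_ge0.
  have VI0 j : 0 <= (V j)^-1%:E * I j by rewrite mule_ge0 ?lee_fin.
  rewrite esumD; [|by move=> j _; apply: mule_ge0; rewrite ?lee_fin..].
  by rewrite !esumZl// lte_add_pinfty// lte_mul_pinfty ?lee_fin.
apply: le_esum => j _.
(* By the ratio hypothesis, [kappa] times the reference entry bounds all the diagonal entries of
   [C j]. *)
have c0 : (0 <= kappa * `|C j i0 i0|)%R by rewrite mulr_ge0// ltW.
have := energy_lattice_le (mu j) (@gh_meas j) (uC j) (dC j) (fun i => ratio j i i0)
  mF r0 c0 Sr FM.
move=> /(lee_wpmul2l (_ : 0 <= (V j)^-1%:E)) => /(_ (iV_ge0 j)) /le_trans; apply.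
have K2V : (0 <= K2 * (V j)^-1)%R by exact: mulr_ge0.
rewrite muleA muleA -(EFinM K2) -ge0_muleDl ?lee_fin//.
apply: lee_wpmul2r; first exact: integral_G_ge0.
rewrite -EFinM -EFinD lee_fin mulrCA /K1 /K2 -(mulrA (M ^+ 2)%R (2 ^+ n)%R) -mulrDr.
by apply: ler_wpM2l; [exact: sqr_ge0|exact: count_div_covolume_le].
Qed.

(** The local integrability condition is tested on a bump centred at [x] whose support avoids [E];
    both lower bounds for its lattice sums are then summed over [j]. *)
Let energy_lty x : open (~` E) -> local_integrability_condition C mu g E -> ~ E x ->
  exists2 e : R, (0 < e)%R &
    \esum_(j in [set: J]) ((V j)^-1%:E * \int[leb]_(w in ball x e) G j w) < +oo /\
    \esum_(j in [set: J]) (\int[leb]_(w in ball x e) G j w) < +oo.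
Proof.
move=> oE lic Ex.
have /nbhs_ballP[e /= e0 eE] : nbhs x (~` E) by apply: open_nbhs_nbhs.
(* Half the radius keeps the closed cube that contains the support inside the open ball of radius
   [e]. *)
pose s : R := (e / 2)%R; have s0 : (0 < s)%R by rewrite divr_gt0.
have SE : ess_supp (fun w => (bump s x w)%:C%C) `<=` ~` E.
  move=> w /(ess_supp_bump_sub s0) xw; apply: eE; split => // i j.
  by rewrite (ord1 i); apply: (le_lt_trans (xw j)); rewrite ltr_pdivrMr// ltr_pMr// ltr1n.
have := lic _ _ (plancherel_wave s0 x) (bump_bounded s0 x) (compact_ess_supp_bump (b := x) s0) SE.
pose I j := \int[leb]_(w in ball x (s / 4)%R) G j w.
pose k : R := (((s / 2) * fejer_mass R) ^+ n ^+ 2)%R.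
have kgt0 : (0 < k)%R.
  by rewrite exprn_gt0// exprn_gt0// mulr_gt0 ?divr_gt0// fejer_mass_gt0.
set T := esum _ _ => Too.
have c0 j : (0 < `|C j i0 i0| / kappa)%R by rewrite divr_gt0// normr_gt0 diag_unit_neq0.
have cC j i : (`|C j i0 i0| / kappa <= `|C j i i|)%R by rewrite ler_pdivrMr// mulrC ratio.
have lowj j := energy_lattice_bump_ge (mu j) (@gh_meas j) (uC j) (dC j) x (c0 j) (cC j) s0.
have finite_of (a : R) (b : J -> \bar R) : (0 < a)%R -> (forall j, 0 <= b j) ->
    \esum_(j in [set: J]) (a%:E * b j) <= T -> \esum_(j in [set: J]) b j < +oo.
  move=> a0 b0; rewrite (esumZl (ltW a0) b0) => bT.
  rewrite -(@lte_pmul2l _ a%:E)// gt0_muley ?lte_fin//.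
  exact: (le_lt_trans bT Too).
exists (s / 4)%R; first by rewrite divr_gt0.
split.
  apply: (finite_of k) => //; first by move=> j; rewrite mule_ge0 ?lee_fin//; exact: integral_G_ge0.
  apply: le_esum => j _; rewrite muleCA; apply: lee_wpmul2l; first by rewrite lee_fin.
  exact: (lowj j).1.
(* The covolume-free constant from counting lattice points of size at most [s / 4], times the lower
   bound [k] for the squared bump. *)
pose rho : R := ((s / 4 / kappa ^+ 2) ^+ n * k)%R.
have rho0 : (0 < rho)%R.
  by rewrite mulr_gt0// exprn_gt0// !divr_gt0// exprn_gt0.
apply: (finite_of rho) => //.
apply: le_esum => j _.
have := lee_wpmul2l (_ : 0 <= (V j)^-1%:E) (lowj j).2.
move=> /(_ (iV_ge0 j)); apply: le_trans.
rewrite muleA; apply: lee_wpmul2r => //.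
rewrite -EFinM lee_fin mulrA (ler_wpM2r (ltW kgt0))//.
by apply: count_div_covolume_ge => //; rewrite divr_ge0// ltW.
Qed.

Lemma lic_calderon_temperate : open (~` E) -> local_integrability_condition C mu g E ->
  calderon_integrability_condition C mu g E /\ strictly_temperate mu g E.
Proof.
move=> oE lic; split; apply: loc_integrable_off_local.
- exact: (measurable_esum VG0 mVG).
- by move=> w; apply: esum_ge0 => j _; exact: VG0.
- move=> x /(energy_lty oE lic)[e e0 [h _]]; exists e => //.
  by rewrite integral_VG//; apply: open_measurable_rV; exact: ball_open.
- exact: (measurable_esum G0 mG).
- by move=> w; apply: esum_ge0 => j _; exact: G0.
- move=> x /(energy_lty oE lic)[e e0 [_ h]]; exists e => //.
  by rewrite integral_esum//; apply: open_measurable_rV; exact: ball_open.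
Qed.

End integrability_conditions.

Theorem corollary4p11 (R : realType) (d : nat) (d_gt0 : (0 < d)%N)
    (J : countType) (C : J -> 'M[R]_d)
    (C_GL : forall j, C j \in unitmx)
    (C_diag : forall j, is_diag_mx (C j))
    (C_sv : exists K : R, forall j,
      max_singular_value (C j) / min_singular_value (C j) <= K)
    (dP : J -> measure_display) (P : forall j, measurableType (dP j))
    (mu : forall j, {sigma_finite_measure set (P j) -> \bar R})
    (g : forall j, P j -> 'rV[R]_d -> R[i])
    (g_gen : forall j, gti_generators (@g j))
    (E : set 'rV[R]_d) (E_closed : closed E)
    (E_null : lebesgue_rV R d E = 0%E) :
  local_integrability_condition C mu g E <->
  calderon_integrability_condition C mu g E /\ strictly_temperate mu g E.
Proof.
have [K CK] := C_sv.
(* Enlarging the constant to at least 1 preserves the ratio bound and makes division by it safe. *)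
have k1 : 1 <= Num.max K 1 by rewrite le_max lexx orbT.
have ratio j a b : `|C j a a| <= Num.max K 1 * `|C j b b|.
  apply: (le_trans (diag_ratio_le (C_GL j) (C_diag j) (CK j) a b)).
  by rewrite ler_wpM2r// le_max lexx.
(* Positive dimension provides a coordinate whose diagonal entry serves as the reference scale of
   every lattice. *)
pose i0 := Ordinal d_gt0.
split=> [lic|[cal temp]].
  by apply: (lic_calderon_temperate i0 C_GL C_diag k1 ratio) => //; exact: closed_openC.
exact: (calderon_temperate_lic i0 C_GL C_diag k1 ratio).
Qed.
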